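(* Let $[G,i,j]:P\to Q$ be an IO-graph morphism. The following are equivalent: (1) $[G,i,j]$ admits a semi-elementary factorization; (2) for every field $\mathbb{F}$ and every $\mathbb{F}$-network $\Gamma$ on $G$ (i.e. every choice of nonzero edge weights), $\operatorname{rank}X([\Gamma,i,j])=2m([\Gamma,i,j])$.
   Context: An IO-graph morphism $[G,i,j]:P\to Q$ between finite sets is a finite undirected multigraph $G$ (vertex set $V$, oriented edges $E$, endpoints $e_\pm$, reverse $\overline e$) with injective $i:P\to V$, $j:Q\to V$, up to isomorphism commuting with $i,j$; inputs $i(P)$, outputs $j(Q)$. The composite of $[G,i,j]:P\to Q$ and $[G',i',j']:Q\to R$ is the disjoint union of $G,G'$ with $j(q)$ identified with $i'(q)$ for $q\in Q$, labelled by $i$ and $j'$. A network on $G$ adds weights $w:E\to\mathbb{F}\setminus\{0\}$ with $w(e)=w(\overline e)$. $X([\Gamma,i,j])\subset(\mathbb{F}^P)^2\times(\mathbb{F}^Q)^2$ is the set of $((x_1,x_2),(y_1,y_2))$ such that there is $u:V\to\mathbb{F}$ with $u(i(p))=x_1(p)$, $u(j(q))=y_1(q)$ and $\Delta u(v)=\sum_{q:j(q)=v}y_2(q)-\sum_{p:i(p)=v}x_2(p)$ for all $v\in V$, where $\Delta u(v)=\sum_{e_+=v}w(e)(u(e_+)-u(e_-))$. For a linear relation $T\subset A\times B$: $\ker T=\{x:(x,0)\in T\}$, $\overline T=\{(y,x):(x,y)\in T\}$, $\operatorname{im}T=\{y:\exists x,(x,y)\in T\}$, $\operatorname{rank}T=\dim\operatorname{im}\overline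 T-\dim\ker T$. $m([\Gamma,i,j])$ is the maximum number of vertex-disjoint paths each starting in $i(P)$ with no other vertex in $i(P)$ and ending in $j(Q)$ with no other vertex in $j(Q)$ (single-vertex paths allowed for vertices in $i(P)\cap j(Q)$). Morphism types: type 1: each component is an isolated vertex that is both input and output, or two vertices joined by a single edge with one endpoint an input and the other an output; type 2: every vertex is both input and output, with arbitrary edges; type 3': every output is also an input and any two outputs lie in different connected components; type 4': every input is also an output and any two inputs lie in different connected components. A semi-elementary factorization is a factorization of $[G,i,j]$ into morphisms of types 1, 2, 3', 4' in which all type 3' factors precede all type 4' factors. *)

(* Defs.v *)
From HB Require Import structures.
From mathcomp Require Import all_boot all_order all_algebra ring.

Set Implicit Arguments.
Unset Strict Implicit.
Unset Printing Implicit Defensive.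

Import GRing.Theory.
Local Open Scope ring_scope.
Local Open Scope quotient_scope.

(* A finite undirected multigraph, presented by oriented edges: an undirected
   edge is a pair {e, rev e} of distinct oriented edges.  Loops and parallel
   edges are allowed. *)
Record multigraph := Multigraph {
  vert : finType;
  edge : finType;
  ehead : edge -> vert;  (* e_+ *)
  etail : edge -> vert;  (* e_- *)
  erev : edge -> edge;
  erevK : involutive erev;
  erev_neq : forall e, erev e != e;
  ehead_rev : forall e, ehead (erev e) = etail e
}.

Record iograph (P Q : finType) := IOGraph {
  graph :> multigraph;
  inp : P -> vert graph;
  out : Q -> vert graph;
  inp_inj : injective inp;
  out_inj : injective out
}.

(* A morphism P -> Q is an iograph up to this relation; the endpoint e_- is
   preserved because e_+ and the reversal are. *)
Definition ioiso (P Q : finType) (G H : iograph P Q) : Prop :=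
  exists (fV : vert G -> vert H) (fE : edge G -> edge H),
    [/\ bijective fV, bijective fE,
        (forall e, ehead (fE e) = fV (ehead e)) /\
        (forall e, erev (fE e) = fE (erev e)),
        (forall p, inp H p = fV (inp G p)) &
        (forall q, out H q = fV (out G q))].

Section Composition.

Variables (P Q R : finType) (G : iograph P Q) (H : iograph Q R).

(* Since [out G] and [inp H] are injective, this relation is already the
   equivalence relation generated by out G q ~ inp H q. *)
Definition glue (x y : vert G + vert H) : bool :=
  match x, y with
  | inl u, inl v => u == v
  | inr u, inr v => u == v
  | inl u, inr v => [exists q, (out G q == u) && (inp H q == v)]
  | inr u, inl v => [exists q, (out G q == v) && (inp H q == u)]
  end.

Lemma glue_refl : reflexive glue.
Proof. by case=> x /=. Qed.

Lemma glue_sym : symmetric glue.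
Proof. by case=> x [] y //=; rewrite eq_sym. Qed.

Lemma glue_trans : transitive glue.
Proof.
move=> [y|y] [x|x] [z|z] /=.
- by move=> /eqP->.
- by move=> /eqP->.
- by move=> + /eqP<-.
- move=> /existsP[q /andP[/eqP<- /eqP<-]] /existsP[q' /andP[/eqP + /eqP<-]].
  by move=> /(@out_inj _ _ G) ->.
- move=> /existsP[q /andP[/eqP<- /eqP<-]] /existsP[q' /andP[/eqP<- /eqP]].
  by move=> /(@inp_inj _ _ H) ->.
- by move=> + /eqP<-.
- by move=> /eqP->.
- by move=> /eqP->.
Qed.

Canonical glue_equiv := EquivRel glue glue_refl glue_sym glue_trans.

Definition glue_vert : finType := quot_type {eq_quot glue_equiv}.

Definition glue_pi (x : vert G + vert H) : glue_vert :=
  \pi_({eq_quot glue_equiv}) x.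

Lemma glue_piP x y : reflect (glue_pi x = glue_pi y) (glue x y).
Proof. by apply: (iffP idP) => [xy|/eqquotP //]; apply/eqquotP. Qed.

Definition glue_edge : finType := (edge G + edge H)%type.

Definition glue_head (e : glue_edge) : glue_vert :=
  match e with
  | inl a => glue_pi (inl (ehead a))
  | inr a => glue_pi (inr (ehead a))
  end.

Definition glue_tail (e : glue_edge) : glue_vert :=
  match e with
  | inl a => glue_pi (inl (etail a))
  | inr a => glue_pi (inr (etail a))
  end.

Definition glue_rev (e : glue_edge) : glue_edge :=
  match e with
  | inl a => inl (erev a)
  | inr a => inr (erev a)
  end.

Lemma glue_revK : involutive glue_rev.
Proof. by case=> a /=; rewrite erevK. Qed.

Lemma glue_rev_neq e : glue_rev e != e.
Proof.
by case: e => a /=; apply/eqP => -[] /eqP; rewrite (negbTE (erev_neq a)).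
Qed.

Lemma glue_head_rev e : glue_head (glue_rev e) = glue_tail e.
Proof. by case: e => a /=; rewrite ehead_rev. Qed.

Definition glue_graph : multigraph :=
  Multigraph glue_revK glue_rev_neq glue_head_rev.

Definition glue_inp (p : P) : vert glue_graph := glue_pi (inl (inp G p)).
Definition glue_out (r : R) : vert glue_graph := glue_pi (inr (out H r)).

Lemma glue_inp_inj : injective glue_inp.
Proof. by move=> p p' /glue_piP /= /eqP /(@inp_inj _ _ G). Qed.

Lemma glue_out_inj : injective glue_out.
Proof. by move=> r r' /glue_piP /= /eqP /(@out_inj _ _ H). Qed.

Definition iocomp : iograph P R := IOGraph glue_inp_inj glue_out_inj.

End Composition.

Section Networks.

Variable F : fieldType.

Record network (G : multigraph) := Network {
  weight : edge G -> F;
  weight_neq0 : forall e, weight e != 0;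
  weight_rev : forall e, weight (erev e) = weight e
}.

Definition laplacian (G : multigraph) (w : network G)
    (u : {ffun vert G -> F^o}) (v : vert G) : F :=
  \sum_(e | ehead e == v) weight w e * (u (ehead e) - u (etail e)).

Section LinearRelations.

Variables A B : vectType F.

Definition pair_swap (z : A * B) : B * A := (z.2, z.1).
Definition pair_zero (x : A) : A * B := (x, 0).
Definition pair_snd (z : A * B) : B := z.2.

Fact pair_swap_linear : linear pair_swap.
Proof. by []. Qed.
Fact pair_zero_linear : linear pair_zero.
Proof. by move=> a x y; congr (_, _) => /=; rewrite scaler0 addr0. Qed.
Fact pair_snd_linear : linear pair_snd.
Proof. by []. Qed.

HB.instance Definition _ :=
  GRing.isLinear.Build F (A * B)%type (B * A)%type _ pair_swap pair_swap_linear.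
HB.instance Definition _ :=
  GRing.isLinear.Build F A (A * B)%type _ pair_zero pair_zero_linear.
HB.instance Definition _ :=
  GRing.isLinear.Build F (A * B)%type B _ pair_snd pair_snd_linear.

Definition linrel := {vspace A * B}.
Definition relswap (T : linrel) : {vspace B * A} := (linfun pair_swap @: T)%VS.
Definition relker (T : linrel) : {vspace A} := (linfun pair_zero @^-1: T)%VS.
Definition relim (T : linrel) : {vspace B} := (linfun pair_snd @: T)%VS.

Lemma mem_relswap (T : linrel) x y : ((y, x) \in relswap T) = ((x, y) \in T).
Proof.
apply/idP/idP => [/memv_imgP[[x' y'] Txy]|Txy].
  by rewrite lfunE /= => -[-> ->].
by apply/memv_imgP; exists (x, y) => //; rewrite lfunE.
Qed.

Lemma mem_relker (T : linrel) x : (x \in relker T) = ((x, 0) \in T).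
Proof. by rewrite -memv_preim lfunE. Qed.

Lemma mem_relim (T : linrel) y :
  reflect (exists x, (x, y) \in T) (y \in relim T).
Proof.
apply: (iffP memv_imgP) => [[[x y'] Txy]|[x Txy]].
  by rewrite lfunE /= => ->; exists x.
by exists (x, y) => //; rewrite lfunE.
Qed.

End LinearRelations.

(* The truncated subtraction is a true one, by [relker_sub_im] below. *)
Definition relrank (A B : vectType F) (T : linrel A B) : nat :=
  (\dim (relim (relswap T)) - \dim (relker T))%N.

Lemma relker_sub_im (A B : vectType F) (T : linrel A B) :
  (relker T <= relim (relswap T))%VS.
Proof.
apply/subvP => x; rewrite mem_relker => Tx0.
by apply/mem_relim; exists 0; rewrite mem_relswap.
Qed.

(* (F^P)^2: the pairs (potential, current). *)
Definition bdata (P : finType) : vectType F :=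
  ({ffun P -> F^o} * {ffun P -> F^o})%type.

Section BoundaryBehaviour.

Variables (P Q : finType) (G : iograph P Q) (w : network G).

(* u is the potential; z = ((x1, x2), (y1, y2)). *)
Definition compatible (u : {ffun vert G -> F^o})
    (z : bdata P * bdata Q) : Prop :=
  [/\ forall p, u (inp G p) = z.1.1 p,
      forall q, u (out G q) = z.2.1 q &
      forall v, laplacian w u v =
        \sum_(q | out G q == v) z.2.2 q - \sum_(p | inp G p == v) z.1.2 p].

(* The failure of [compatible], as a linear map. *)
Definition defect
    (t : ({ffun vert G -> F^o} * (bdata P * bdata Q))%type) :
    ({ffun P -> F^o} * {ffun Q -> F^o} * {ffun vert G -> F^o})%type :=
  ([ffun p => t.1 (inp G p) - t.2.1.1 p],
   [ffun q => t.1 (out G q) - t.2.2.1 q],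
   [ffun v => laplacian w t.1 v -
     (\sum_(q | out G q == v) t.2.2.2 q - \sum_(p | inp G p == v) t.2.1.2 p)]).

Fact defect_linear : linear defect.
Proof.
move=> a [u [[x1 x2] [y1 y2]]] [u' [[x1' x2'] [y1' y2']]].
congr (_, _, _); apply/ffunP => k; rewrite !ffunE /=.
- by rewrite scalerBr addrACA -opprD.
- by rewrite scalerBr addrACA -opprD.
have scE (b c : F^o) : b *: c = (b : F) * (c : F) by [].
have lapE : laplacian w (a *: u + u') k = a * laplacian w u k + laplacian w u' k.
  rewrite /laplacian big_distrr -big_split /=; apply: eq_bigr => e _.
  by rewrite !ffunE !scE; ring.
have sumE (I : finType) (r : pred I) (f g : {ffun I -> F^o}) :
    \sum_(i | r i) (a *: f + g) i =
    (a : F) * \sum_(i | r i) f i + \sum_(i | r i) g i.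
  by rewrite big_distrr -big_split /=; apply: eq_bigr => i _; rewrite !ffunE.
by rewrite lapE !sumE !scE; ring.
Qed.

HB.instance Definition _ := GRing.isLinear.Build _ _ _ _ defect defect_linear.

(* The set of all z compatible with some u, see [mem_Xrel]. *)
Definition Xrel : linrel (bdata P) (bdata Q) :=
  relim (lker (linfun defect)).

Lemma mem_Xrel z : reflect (exists u, compatible u z) (z \in Xrel).
Proof.
apply: (iffP (mem_relim _ _)) => -[u uz]; exists u; move: uz.
  rewrite memv_ker lfunE => /eqP[/ffunP eP /ffunP eQ /ffunP eV].
  by split=> k; apply/eqP; rewrite -subr_eq0; apply/eqP;
    [move: (eP k)|move: (eQ k)|move: (eV k)]; rewrite !ffunE.
case=> eP eQ eV; rewrite memv_ker lfunE; apply/eqP.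
by congr (_, _, _); apply/ffunP => k; rewrite !ffunE ?(eP, eQ, eV) subrr.
Qed.

End BoundaryBehaviour.

End Networks.

Section Connectivity.

Variable G : multigraph.

Definition adj (x y : vert G) : bool :=
  [exists e : edge G, (etail e == x) && (ehead e == y)].

Definition component (v : vert G) : {set vert G} :=
  [set x | connect adj v x].

Definition component_edges (v : vert G) : {set edge G} :=
  [set e | ehead e \in component v].

End Connectivity.

Section Paths.

Variables (P Q : finType) (G : iograph P Q).

Definition is_input (v : vert G) : bool := v \in codom (inp G).
Definition is_output (v : vert G) : bool := v \in codom (out G).

(* A path is given by its sequence of distinct vertices. *)
Definition io_path (s : seq (vert G)) : bool :=
  if s is x :: s' then
    [&& path (@adj G) x s', uniq s,
        is_input x, all (predC is_input) s',
        is_output (last x s') & all (predC is_output) (belast x s')]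
  else false.

(* A path has at most #|vert G| vertices, so [#|vert G|.-bseq] is no
   restriction. *)
Definition disjoint_io_paths (S : {set #|vert G|.-bseq (vert G)}) : bool :=
  [forall s in S, io_path s] &&
  [forall s in S, forall t in S, (s != t) ==> [disjoint s & t]].

Definition max_paths : nat := \max_(S | disjoint_io_paths S) #|S|.

End Paths.

Section Types.

Variables (P Q : finType) (G : iograph P Q).

Definition isolated_io (v : vert G) : Prop :=
  [/\ component v = [set v], component_edges v = set0,
      is_input v & is_output v].

(* e may be reversed, so its tail can be taken to be the input. *)
Definition single_edge_io (v : vert G) : Prop :=
  exists e : edge G,
    [/\ etail e != ehead e,
        component v = [set etail e; ehead e],
        component_edges v = [set e; erev e],
        is_input (etail e) && ~~ is_output (etail e) &
        is_output (ehead e) && ~~ is_input (ehead e)].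

Definition type1 : Prop :=
  forall v : vert G, isolated_io v \/ single_edge_io v.

Definition type2 : Prop :=
  forall v : vert G, is_input v && is_output v.

Definition type3' : Prop :=
  (forall v : vert G, is_output v -> is_input v) /\
  (forall v v' : vert G, is_output v -> is_output v' -> v != v' ->
     component v != component v').

Definition type4' : Prop :=
  (forall v : vert G, is_input v -> is_output v) /\
  (forall v v' : vert G, is_input v -> is_input v' -> v != v' ->
     component v != component v').

End Types.

Inductive iotype := Type1 | Type2 | Type3' | Type4'.

Definition has_type (t : iotype) (P Q : finType) (G : iograph P Q) : Prop :=
  match t with
  | Type1 => type1 G
  | Type2 => type2 G
  | Type3' => type3' G
  | Type4' => type4' G
  end.

(* Nonempty composable sequences of morphisms, listed from the input side to
   the output side, each labelled by a type. *)
Inductive factors : finType -> finType -> Type :=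
| LastFactor P Q (t : iotype) (G : iograph P Q) : factors P Q
| ConsFactor P Q R (t : iotype) (G : iograph P Q) (c : factors Q R) :
    factors P R.

Fixpoint compose P Q (c : factors P Q) : iograph P Q :=
  match c with
  | LastFactor _ _ _ G => G
  | ConsFactor _ _ _ _ G c' => iocomp G (compose c')
  end.

Fixpoint labels P Q (c : factors P Q) : seq iotype :=
  match c with
  | LastFactor _ _ t _ => [:: t]
  | ConsFactor _ _ _ t _ c' => t :: labels c'
  end.

Fixpoint well_labelled P Q (c : factors P Q) : Prop :=
  match c with
  | LastFactor _ _ t G => has_type t G
  | ConsFactor _ _ _ t G c' => has_type t G /\ well_labelled c'
  end.

Definition may_precede (s t : iotype) : bool :=
  match s, t with
  | Type4', Type3' => false
  | _, _ => true
  end.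

Definition semi_elementary P Q (G : iograph P Q) : Prop :=
  exists c : factors P Q,
    [/\ well_labelled c, pairwise may_precede (labels c) &
        ioiso (compose c) G].

(* Main.v *)
(** Write the composite of relations as T = T2 o T1. Since
    rank T = dim im T - dim T(0), the rank of T is at most those of T1 and T2
    and at most the dimension of the middle space. By Menger's theorem [G] is a
    composite through a separating set of [max_paths G] vertices, so
    rank X <= 2 m always.

    Factors of types 1, 2, 3' have X a surjective partial function, and
    composing with one on the input side does not change the rank; dually for
    types 1, 2, 4'. Hence a semi-elementary factorization gives rank X = 2 |S|
    for the separating set S between the two kinds of factors, and m <= |S|.

    Conversely, split G = G2 o G1 at a separating set of size m. Rank 2 m
    forces (0, y) in X(G1) to imply y = 0, and dually for G2. Given this
    property, split off from the input side: edges between inputs (type 2),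
    pieces attached to at most one input and containing no output (type 3'),
    and inputs of degree one (type 1). When nothing can be split off, take a
    generic flow f conserved off the outputs and a potential u vanishing exactly
    on the inputs and constant exactly along the edges where all flows vanish.
    The weights f / du make u harmonic off the outputs, so u and f vanish at the
    outputs, which by genericity makes the remaining graph of type 3'. *)
Require Import Defs.
From mathcomp Require Import all_boot all_order all_algebra.
From mathcomp Require Import ring zify.
From Stdlib Require Import Classical_Prop Classical_Pred_Type.

Set Implicit Arguments.
Unset Strict Implicit.
Unset Printing Implicit Defensive.

Import Order.TTheory GRing.Theory Num.Theory.

(** * Menger's theorem *)

Section Menger.

Variable T : finType.
Implicit Types (e : rel T) (A B : pred T) (L R : {set T}) (s : seq T).

(** The relation [e] may be asymmetric, so only arcs from the [L] side to the [R] side are excluded.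
    The separating set is [L :&: R]; recording both sides lets two separations be combined by
    intersections and unions. *)
Definition separation e A B L R : bool :=
  [&& [forall x, A x ==> (x \in L)], [forall x, B x ==> (x \in R)],
      L :|: R == setT & [forall x in L :\: R, forall y in R :\: L, ~~ e x y]].

Lemma separationP e A B L R :
  reflect [/\ forall x, A x -> x \in L, forall x, B x -> x \in R,
              forall x, (x \in L) || (x \in R) &
              forall x y, x \notin R -> y \notin L -> ~~ e x y]
    (separation e A B L R).
Proof.
apply: (iffP and4P) => [[/forallP hA /forallP hB /eqP LR /forall_inP h]|[hA hB LR h]].
  have cov x : (x \in L) || (x \in R) by rewrite -in_setU LR inE.
  split=> // [x /(implyP (hA x)) | x /(implyP (hB x)) | x y xR yL] //.
  have xD : x \in L :\: R by move: (cov x); rewrite inE (negbTE xR) orbF.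
  have yD : y \in R :\: L by move: (cov y); rewrite inE (negbTE yL).
  by have /forall_inP := h x xD; apply.
split.
- by apply/forallP => x; apply/implyP/hA.
- by apply/forallP => x; apply/implyP/hB.
- by apply/eqP/setP => x; rewrite !inE LR.
- apply/forall_inP => x /setDP[_ xR]; apply/forall_inP => y /setDP[_ yL].
  exact: h.
Qed.

(** The shape of [io_path] with arbitrary sources and sinks, so that the induction in [menger] can
    replace one end by a separating set. *)
Definition linking e A B s : bool :=
  if s is x :: s' then
    [&& path e x s', uniq s, A x, all (predC A) s',
        B (last x s') & all (predC B) (belast x s')]
  else false.

Lemma sub_linking e e' A B s :
  subrel e e' -> linking e A B s -> linking e' A B s.
Proof.
move=> ee'; case: s => //= x s /andP[p ->].
by rewrite (sub_path ee' p).
Qed.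

(** The path is cut at its first vertex in [B]. *)
Lemma walk_prefix e B x s : path e x s -> uniq (x :: s) -> B (last x s) ->
  exists s', [/\ path e x s', uniq (x :: s'), B (last x s'),
    all (predC B) (belast x s') & {subset x :: s' <= x :: s}].
Proof.
elim: s x => [|y s IH] x /=; first by move=> _ _ Bx; exists [::]; split.
case/andP=> xy ys /andP[xs us] Bl.
have [Bx|nBx] := boolP (B x).
  by exists [::]; split=> // z; rewrite !inE => ->.
have [s' [p' u' B' a' sub]] := IH y ys us Bl.
exists (y :: s'); split=> //=.
- by rewrite xy.
- by rewrite [X in _ && X]u' andbT; apply: contra xs => /sub.
- by rewrite nBx a'.
- by move=> z; rewrite inE => /orP[/eqP->|/sub zs]; rewrite inE ?eqxx // zs orbT.
Qed.

(** The path is cut at its last vertex in [A], reached by passing to the tail at a later vertex of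
    [A] until there is none. *)
Lemma walk_suffix e A B x s : path e x s -> uniq (x :: s) -> A x ->
    B (last x s) -> all (predC B) (belast x s) ->
  exists2 s', linking e A B s' & {subset s' <= x :: s}.
Proof.
move: {2}(size s) (leqnn (size s)) => n; elim: n x s => [|n IH] x s.
  by case: s => //= _ _ _ Ax Bx _; exists [:: x] => //=; rewrite Ax Bx.
move=> sz p u Ax Bl nB.
have [nA|] := boolP (all (predC A) s).
  by exists (x :: s) => //; apply/and5P; split=> //; apply/andP.
case/allPn => y ys /negPn Ay.
move: sz p u Bl nB; case/splitPr: ys => s1 s2 sz.
rewrite cat_path /= => /and3P[_ _ p2] u; rewrite last_cat belast_cat all_cat /=.
move=> B2 /and3P[_ _ nB2].
have u2 : uniq (y :: s2) by move: u; rewrite cat_uniq => /andP[_ /and3P[]].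
have sz2 : size s2 <= n.
  by apply: leq_trans (_ : size s1 + size s2 <= n); [exact: leq_addl | rewrite -ltnS -addnS -[_ + _](size_cat s1 (y :: s2))].
have [s' l' sub] := IH y s2 sz2 p2 u2 Ay B2 nB2.
by exists s' => // z /sub zs; rewrite inE mem_cat zs !orbT.
Qed.

Lemma walk_linking e A B x s : path e x s -> A x -> B (last x s) ->
  exists2 s', linking e A B s' & {subset s' <= x :: s}.
Proof.
move=> p Ax; case/shortenP: p => s1 p1 u1 sub1 B1.
have [s2 [p2 u2 B2 nB2 sub2]] := walk_prefix p1 u1 B1.
have [s3 l3 sub3] := walk_suffix p2 u2 Ax B2 nB2.
exists s3 => // z /sub3 /sub2; rewrite !inE => /orP[->//|/sub1 ->].
by rewrite orbT.
Qed.

(** The first vertex of the path that lies in [R] is still in [L], since no arc jumps from outside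
    [R] to outside [L]. *)
Lemma linking_meets_separation e A B L R s :
  separation e A B L R -> linking e A B s -> exists2 v, v \in s & v \in L :&: R.
Proof.
case/separationP=> hA hB cov sep; case: s => //= x s.
case/and5P=> p _ /hA xL _ /andP[/hB lR _].
elim: s x p xL lR => [|y s IH] x /=.
  by move=> _ xL xR; exists x; rewrite ?inE ?eqxx ?xL.
case/andP=> xy ys xL lR.
have [xR|xR] := boolP (x \in R); first by exists x; rewrite ?inE ?eqxx ?xL.
have yL : y \in L by apply: contraTT xy => /(sep _ _ xR).
by have [v vs vLR] := IH y ys yL lR; exists v => //; rewrite inE vs orbT.
Qed.

(* Left of a separation: a linking towards a set [X] containing [L :&: R]
   cannot leave [L], since it stops as soon as it meets [X]. *)
Lemma linking_left e A B (X : {set T}) L R s :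
  separation e A B L R -> {subset L :&: R <= X} -> {subset X <= L} ->
  linking e A [in X] s -> {subset s <= L}.
Proof.
case/separationP=> hA hB cov sep SX XL; case: s => //= x s.
case/and5P=> p _ /hA xL _ /andP[_ nX].
elim: s x p xL nX => [|y s IH] x /=; first by move=> _ xL _ z; rewrite inE => /eqP->.
case/andP=> xy ys xL /andP[xX nX].
have xR : x \notin R by apply: contra xX => xR; apply: SX; rewrite inE xL.
have yL : y \in L by apply: contraTT xy => /(sep _ _ xR).
by move=> z; rewrite inE => /orP[/eqP->|/(IH y ys yL nX)].
Qed.

(** Mirror image of [linking_left], by induction from the end of the path. *)
Lemma linking_right e A B (Y : {set T}) L R s :
  separation e A B L R -> {subset L :&: R <= Y} -> {subset Y <= R} ->
  linking e [in Y] B s -> {subset s <= R}.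
Proof.
case/separationP=> hA hB cov sep SY YR; case: s => //= x s.
case/and5P=> p _ xY nY /andP[/hB lR _].
have sR : {subset s <= R}.
  elim: s x {xY} p nY lR => [|y s IH] x //= /andP[_ p] /andP[yY nY] lR.
  have sR := IH y p nY lR; move=> z; rewrite inE => /orP[/eqP->|/sR//].
  case: s {IH} p nY lR sR => [|t s] //= /andP[yt _] /andP[tY _] _ sR.
  have tR : t \in R by apply: sR; rewrite inE eqxx.
  have tL : t \notin L by apply: contra tY => tL; apply: SY; rewrite inE tL.
  by apply: contraTT yt => yR; apply: sep.
by move=> z; rewrite inE => /orP[/eqP->|/sR//]; apply: YR.
Qed.

(** Uncrossing: the deleted arc [xy] does no harm when it is put back, because its source [x] is one
    of the sinks and so lies in [R']. Hence a lower bound on separations in [e] passes to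
    separations of [A] from [x |: L :&: R] in [e']. *)
Lemma separation_push e e' A B (x y : T) L R L' R' :
    (forall s t : T, e s t -> e' s t \/ s = x /\ t = y) ->
    separation e' A B L R ->
    separation e' A [in x |: L :&: R] L' R' -> x \in L ->
  separation e A B (L' :&: L) (R' :|: R) /\
  #|(L' :&: L) :&: (R' :|: R)| <= #|L' :&: R'|.
Proof.
move=> ee' /separationP[hA hB cov sep] /separationP[hA' hX cov' sep'] xL.
have SR z : z \in L -> z \in R -> z \in R'.
  by move=> zL zR; apply: hX; rewrite !inE zL zR orbT.
split; last first.
  apply/subset_leq_card/subsetP => z; rewrite !inE => /andP[/andP[-> zL]].
  by case/orP=> // /(SR _ zL).
apply/separationP; split=> [z Az|z /hB zR|z|s t].
- by rewrite inE hA ?hA'.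
- by rewrite inE zR orbT.
- rewrite !inE; case/orP: (cov z) => [zL|->]; last by rewrite !orbT.
  by case/orP: (cov' z) => ->; rewrite ?zL ?orbT.
rewrite !inE negb_or negb_and => /andP[sR' sR] tLL; apply/negP => /ee'[st|[sx _]].
  by case/orP: tLL => tL; [have := sep' _ _ sR' tL | have := sep _ _ sR tL]; rewrite st.
by case/negP: sR'; rewrite sx; apply: hX; rewrite !inE eqxx.
Qed.

(** Mirror image of [separation_push]: here the target [y] of the arc is one of the sources and lies
    in [L']. *)
Lemma separation_pull e e' A B (x y : T) L R L' R' :
    (forall s t : T, e s t -> e' s t \/ s = x /\ t = y) ->
    separation e' A B L R ->
    separation e' [in y |: L :&: R] B L' R' -> y \in R ->
  separation e A B (L' :|: L) (R' :&: R) /\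
  #|(L' :|: L) :&: (R' :&: R)| <= #|L' :&: R'|.
Proof.
move=> ee' /separationP[hA hB cov sep] /separationP[hY hB' cov' sep'] yR.
have SL z : z \in L -> z \in R -> z \in L'.
  by move=> zL zR; apply: hY; rewrite !inE zL zR orbT.
split; last first.
  apply/subset_leq_card/subsetP => z; rewrite !inE => /andP[zL /andP[-> zR]].
  by rewrite andbT; case/orP: zL => // /SL; apply.
apply/separationP; split=> [z /hA zL|z Bz|z|s t].
- by rewrite inE zL orbT.
- by rewrite inE hB ?hB'.
- rewrite !inE; case/orP: (cov z) => [->|zR]; first by rewrite !orbT.
  by case/orP: (cov' z) => ->; rewrite ?zR ?orbT.
rewrite !inE negb_or negb_and => sRR /andP[tL' tL]; apply/negP => /ee'[st|[_ ty]].
  by case/orP: sRR => sR; [have := sep' _ _ sR tL' | have := sep _ _ sR tL]; rewrite st.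
by case/negP: tL'; rewrite ty; apply: hY; rewrite !inE eqxx.
Qed.

Definition disjoint_linkings e A B k (p : 'I_k -> seq T) :=
  (forall i, linking e A B (p i)) /\ (forall i j v, v \in p i -> v \in p j -> i = j).

(** The joined walk is shortened to a linking by [walk_linking]. Only the containment of its
    vertices is kept, which is what disjointness of the assembled family needs. *)
Lemma linking_cat e A B (X Y : {set T}) (x y : T) s t :
    linking e A [in X] (rcons s x) -> linking e [in Y] B (y :: t) ->
    (x == y) || e x y -> 
    {subset [predI rcons s x & y :: t] <= pred2 x y} ->
  exists2 z, linking e A B z & {subset z <= rcons s x ++ y :: t}.
Proof.
move=> ls /= /and5P[pt _ _ _ /andP[Bl _]] xy dj.
have [z lz sub] : exists2 z, linking e A B z
    & {subset z <= rcons s x ++ (if x == y then t else y :: t)}.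
  case: s ls dj => [|x0 s] /and5P[ps _ Ax _ _] _.
    apply: (walk_linking (x := x)) => //; first by case: (x =P y) xy => /= [->|_ ->].
    by case: (x =P y) => [->|].
  apply: (walk_linking (x := x0)) => //.
    rewrite cat_path ps last_rcons /=.
    by case: (x =P y) xy => /= [->|_ ->].
  by rewrite last_cat last_rcons; case: (x =P y) => [->|].
exists z => // v /sub; rewrite !mem_cat => /orP[->//|].
by case: ifP => _ vt; rewrite ?vt ?inE ?vt ?orbT.
Qed.

(* Goring's proof: delete an arc xy; if this creates a separation of order
   below k, then its k - 1 vertices together with x (resp. y) are linked to the
   sources (resp. sinks) by k disjoint paths, which fit together. *)
Lemma menger e A B k :
    (forall L R, separation e A B L R -> k <= #|L :&: R|) ->
  exists p : 'I_k -> seq T, disjoint_linkings e A B p.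
Proof.
move: {2}#|_| (leqnn #|[set q : T * T | e q.1 q.2]|) => n.
elim: n e A B => [|n IH] e A B en hk.
  have ne x y : e x y = false.
    move: en; rewrite leqn0 cards_eq0 => /eqP/setP/(_ (x, y)).
    by rewrite !inE.
  set D := [set x | A x && B x].
  have kD : k <= #|D|.
    (* Without arcs any two covering sets separate; this pair has [A] and [B] in common. *)
    have -> : D = [set x | A x] :&: (~: [set x | A x] :|: [set x | B x]).
      by apply/setP => x; rewrite !inE; case: (A x).
    apply/hk/separationP; split=> [x Ax|x Bx|x|x y _ _].
    - by rewrite inE.
    - by rewrite !inE Bx orbT.
    - by rewrite !inE; case: (A x).
    - by rewrite ne.
  exists (fun i => [:: enum_val (widen_ord kD i)]); split=> [i|i j v].
    by have := enum_valP (widen_ord kD i); rewrite inE => /andP[/= -> ->].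
  by rewrite !inE => /eqP-> /eqP/enum_val_inj/(congr1 val) /= ij; apply: val_inj.
have [[x y] /= exy|ne] := pickP [pred q : T * T | e q.1 q.2]; last first.
  by apply: IH hk; rewrite (_ : [set _ | _] = set0) ?cards0 //; apply/setP => q; rewrite !inE; apply: ne.
pose e' : rel T := fun s t : T => e s t && ((s, t) != (x, y)).
have e'e : subrel e' e by move=> ? ? /andP[].
have ee' (s t : T) : e s t -> e' s t \/ s = x /\ t = y.
  by rewrite /e' => ->; have [[-> ->]|] := altP ((s, t) =P (x, y)); [right|left].
have e'n : #|[set q : T * T | e' q.1 q.2]| <= n.
  rewrite -ltnS; apply: leq_trans en; apply: proper_card; apply/properP; split.
    by apply/subsetP => q; rewrite !inE => /e'e.
  by exists (x, y); rewrite !inE //= /e' eqxx andbF.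
have [/existsP[[L R] /= /andP[sep Sk]]|] :=
    boolP [exists q : {set T} * {set T},
             separation e' A B q.1 q.2 && (#|q.1 :&: q.2| < k)]; last first.
  move/existsPn=> nsep; have [L R sep|p [lp dp]] := IH e' A B e'n.
    by have := nsep (L, R); rewrite /= sep /= -leqNgt.
  by exists p; split=> // i; apply: sub_linking (lp i).
have /separationP[hA hB cov nLR] := sep.
(* Otherwise [(L, R)] would already be a separation in [e], of order below [k]. *)
have [xR yL] : x \notin R /\ y \notin L.
  apply/andP; apply: contraLR Sk => nxy; rewrite -leqNgt; apply: hk.
  apply/separationP; split=> // s t sR tL; apply/negP => /ee'[|[sx ty]].
    by apply/negP/nLR.
  by move: nxy; rewrite -sx -ty sR tL.
have xL : x \in L by move: (cov x); rewrite (negbTE xR) orbF.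
have yR : y \in R by move: (cov y); rewrite (negbTE yL).
set X := x |: L :&: R; set Y := y |: L :&: R.
(* Adding [x] to [R] absorbs the arc [xy], so [(L, x |: R)] is a separation in [e] and has order at
   least [k]. *)
have cX : #|X| = k.
  have cX1 : #|X| = #|L :&: R|.+1 by rewrite cardsU1 inE (negbTE xR) andbF.
  apply/eqP; rewrite eqn_leq {1}cX1 Sk.
  suff : k <= #|L :&: (x |: R)|.
    move/leq_trans; apply.
    apply/subset_leq_card/subsetP => z; rewrite !inE.
    by case/andP=> -> /orP[->//|->]; rewrite orbT.
  apply/hk/separationP; split=> [//|z /hB|z|s t].
  - by rewrite !inE => ->; rewrite orbT.
  - by rewrite !inE; case/orP: (cov z) => ->; rewrite ?orbT.
  rewrite !inE negb_or => /andP[sx sR] tL; apply/negP => /ee'[|[/eqP]].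
    exact/negP/nLR.
  by rewrite (negbTE sx).
have cY : #|Y| = k.
  have cY1 : #|Y| = #|L :&: R|.+1 by rewrite cardsU1 inE (negbTE yL).
  apply/eqP; rewrite eqn_leq {1}cY1 Sk.
  suff : k <= #|(y |: L) :&: R|.
    move/leq_trans; apply.
    apply/subset_leq_card/subsetP => z; rewrite !inE.
    by case/andP=> /orP[->//|->] ->; rewrite orbT.
  apply/hk/separationP; split=> [z /hA|//|z|s t].
  - by rewrite !inE => ->; rewrite orbT.
  - by rewrite !inE; case/orP: (cov z) => ->; rewrite ?orbT.
  rewrite !inE negb_or => sR /andP[ty tL]; apply/negP => /ee'[|[_ /eqP]].
    exact/negP/nLR.
  by rewrite (negbTE ty).
have [L' R' sep'|p [lp dp]] := IH e' A [in X] e'n.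
  have [sepe le] := separation_push ee' sep sep' xL.
  exact: leq_trans (hk _ _ sepe) le.
have [L' R' sep'|q [lq dq]] := IH e' [in Y] B e'n.
  have [sepe le] := separation_pull ee' sep sep' yR.
  exact: leq_trans (hk _ _ sepe) le.
have pL i : {subset p i <= L}.
  apply: linking_left sep _ _ (lp i) => z; rewrite !inE; first by move->; rewrite orbT.
  by case/orP=> [/eqP->|/andP[]].
have qR i : {subset q i <= R}.
  apply: linking_right sep _ _ (lq i) => z; rewrite !inE; first by move->; rewrite orbT.
  by case/orP=> [/eqP->|/andP[]].
have pE i : {z & {s | [/\ p i = rcons s z, z \in X & {in s, forall v, v \notin X}]}}.
  case: (p i) (lp i) => //= x0 s /and5P[_ _ _ _ /andP[lX nX]].
  exists (last x0 s), (belast x0 s); rewrite -lastI; split=> //.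
  exact/allP.
have qE i : {z & {s | [/\ q i = z :: s, z \in Y & {in s, forall v, v \notin Y}]}}.
  case: (q i) (lq i) => //= x0 s /and5P[_ _ xY nY _].
  by exists x0, s; split=> //; apply/allP.
pose z i := projT1 (pE i); pose y' i := projT1 (qE i).
have pzP i : exists s, [/\ p i = rcons s (z i), z i \in X & {in s, forall v, v \notin X}].
  by rewrite /z; case: (pE i) => u [s ?]; exists s.
have qyP i : exists s, [/\ q i = y' i :: s, y' i \in Y & {in s, forall v, v \notin Y}].
  by rewrite /y'; case: (qE i) => u [s ?]; exists s.
have zp i : z i \in p i by have [s [-> _ _]] := pzP i; rewrite mem_rcons inE eqxx.
have yq i : y' i \in q i by have [s [-> _ _]] := qyP i; rewrite inE eqxx.
have z_inj : injective z.
  by move=> i j zij; apply: (dp i j (z i)) => //; rewrite zij.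
have y'_inj : injective y'.
  by move=> i j yij; apply: (dq i j (y' i)) => //; rewrite yij.
have y'_surj v : v \in Y -> exists j, y' j = v.
  have -> : Y = [set y' j | j : 'I_k].
    apply/esym/eqP; rewrite eqEcard card_imset // cY card_ord leqnn andbT.
    by apply/subsetP => _ /imsetP[j _ ->]; have [s []] := qyP j.
  by case/imsetP=> j _ ->; exists j.
(* The end of a left path is matched with the start of a right path: a vertex of the separator with
   itself, and [x] with [y] across the deleted arc. *)
pose phi v := if v == x then y else v.
have phiY i : phi (z i) \in Y.
  have [s [_ zX _]] := pzP i; move: zX; rewrite /phi; case: eqP => [_|nx].
    by rewrite !inE eqxx.
  by rewrite !inE => /orP[/eqP//|->]; rewrite orbT.
have /fin_all_exists[tau tauP] i : exists j, y' j = phi (z i) by apply: y'_surj.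
have yX : y \notin X by rewrite !inE (negbTE yL) orbF; apply: contra xR => /eqP<-.
have zX i : z i \in X by have [s []] := pzP i.
have tau_inj : injective tau.
  move=> i j tij; apply: z_inj; have : phi (z i) = phi (z j) by rewrite -!tauP tij.
  rewrite /phi; case: eqP => [->|_]; case: eqP => [->|_] // E.
    by case/negP: yX; rewrite E.
  by case/negP: yX; rewrite -E.
(* Left paths stay in [L] and right paths in [R], so they meet only in the separator, where both
   have an end. *)
have pq i j v : v \in p i -> v \in q j -> v = z i /\ v = y' j /\ v \in L :&: R.
  move=> vp vq; have vS : v \in L :&: R by rewrite inE (pL i) ?(qR j).
  have vX : v \in X by rewrite in_setU vS orbT.
  have vY : v \in Y by rewrite in_setU vS orbT.
  have [s [Ep _ ns]] := pzP i; have [t [Eq _ nt]] := qyP j.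
  move: vp vq; rewrite Ep Eq mem_rcons !in_cons.
  case/orP=> [/eqP vz|/ns]; last by rewrite vX.
  by case/orP=> [/eqP vy|/nt]; last by rewrite vY.
have pq_tau i j v : v \in p i -> v \in q j -> j = tau i.
  move=> vp vq; have [vz [vy vS]] := pq _ _ _ vp vq.
  apply: y'_inj; rewrite tauP -vy /phi -vz ifN //.
  by apply: contraTneq vS => ->; rewrite inE (negbTE xR) andbF.
have r_ex i : exists r, linking e A B r /\ {subset r <= p i ++ q (tau i)}.
  have [s [Ep _ _]] := pzP i; have [t [Eq _ _]] := qyP (tau i).
  have lpi := sub_linking e'e (lp i); have lqi := sub_linking e'e (lq (tau i)).
  rewrite Ep in lpi; rewrite Eq in lqi.
  have [|v|r lr sub] := linking_cat lpi lqi.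
  - by rewrite tauP /phi; case: (z i =P x) => [->|_]; rewrite ?exy ?orbT ?eqxx.
  - case/andP=> vp vq; have [|| -> _] := pq i (tau i) v.
    + by rewrite Ep.
    + by rewrite Eq.
    + by rewrite inE /= eqxx.
  by exists r; split=> //; rewrite Ep Eq.
have /fin_all_exists[r rP] := r_ex.
exists r; split=> [i|i j v]; first by have [] := rP i.
have [_ subi] := rP i; have [_ subj] := rP j.
move=> /subi; rewrite mem_cat => vi /subj; rewrite mem_cat => vj.
case/orP: vi => vi; case/orP: vj => vj.
- exact: dp vi vj.
- exact/tau_inj/esym/(pq_tau _ _ _ vi vj).
- exact/tau_inj/(pq_tau _ _ _ vj vi).
- exact/tau_inj/(dq _ _ _ vi vj).
Qed.

End Menger.

(** * Composition as gluing *)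

Lemma inj_surj_bij (S T : finType) (f : S -> T) :
  injective f -> (forall y, exists x, f x = y) -> bijective f.
Proof.
move=> finj /fin_all_exists[g gK]; exists g => x //; exact: finj.
Qed.

(* [G] is the union of embedded copies of [A] and [B] which share exactly the
   vertices labelled by [Q]: the universal description of [iocomp A B]. *)
Record gluing (P Q R : finType) (A : iograph P Q) (B : iograph Q R)
    (G : iograph P R) := Gluing {
  vl : vert A -> vert G;
  vr : vert B -> vert G;
  el : edge A -> edge G;
  er : edge B -> edge G;
  el_inj : injective el;
  er_inj : injective er;
  el_er : forall a b, el a <> er b;
  el_er_cover : forall e, (exists a, el a = e) \/ (exists b, er b = e);
  vl_inj : injective vl;
  vr_inj : injective vr;
  vl_vr_cover : forall v, (exists a, vl a = v) \/ (exists b, vr b = v);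
  vl_vr : forall a b, vl a = vr b <-> exists2 q, out A q = a & inp B q = b;
  head_el : forall e, ehead (el e) = vl (ehead e);
  head_er : forall e, ehead (er e) = vr (ehead e);
  rev_el : forall e, erev (el e) = el (erev e);
  rev_er : forall e, erev (er e) = er (erev e);
  inp_vl : forall p, inp G p = vl (inp A p);
  out_vr : forall r, out G r = vr (out B r)
}.

Definition glued (P Q R : finType) (A : iograph P Q) (B : iograph Q R)
  (G : iograph P R) : Prop := inhabited (gluing A B G).

Lemma vl_out (P Q R : finType) (A : iograph P Q) (B : iograph Q R)
  (G : iograph P R) (g : gluing A B G) q : vl g (out A q) = vr g (inp B q).
Proof. by apply/vl_vr; exists q. Qed.

Section IOComp.

Variables (P Q R : finType) (A : iograph P Q) (B : iograph Q R).

Lemma glue_pi_surj (v : glue_vert A B) : exists x, glue_pi x = v.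
Proof. by exists (repr v); rewrite /glue_pi reprK. Qed.

Lemma glue_vert_lift (T : Type) (h : vert A + vert B -> T) :
    (forall x y, glue x y <-> h x = h y) ->
  exists2 f : glue_vert A B -> T, injective f & forall x, f (glue_pi x) = h x.
Proof.
move=> hP; exists (fun v => h (repr v)) => [v w|x].
  by move/hP/glue_piP; rewrite /glue_pi !reprK.
by apply/hP/glue_piP; rewrite /glue_pi reprK.
Qed.

Lemma gluing_iocomp : gluing A B (iocomp A B).
Proof.
exists (fun a => glue_pi (inl a)) (fun b => glue_pi (inr b)) inl inr => //.
- by move=> a b [].
- by move=> a b [].
- by case=> [a|b]; [left; exists a|right; exists b].
- by move=> a b /glue_piP/eqP.
- by move=> a b /glue_piP/eqP.
- by move=> v; have [[a|b] <-] := glue_pi_surj v; [left; exists a|right; exists b].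
- move=> a b; split=> [/glue_piP/existsP[q /andP[/eqP<- /eqP<-]]|[q <- <-]].
    by exists q.
  by apply/glue_piP/existsP; exists q; rewrite !eqxx.
Qed.

(** The two embeddings induce a map on the quotient, injective because they overlap exactly in the
    glued labels and surjective because they cover [G]. *)
Lemma gluing_iso (G : iograph P R) : gluing A B G -> ioiso (iocomp A B) G.
Proof.
move=> g; pose h x := match x with inl a => vl g a | inr b => vr g b end.
have [x y|f finj fE] := @glue_vert_lift _ h.
  case: x y => [a|b] [a'|b'] /=.
  - by split=> [/eqP->//|/vl_inj->].
  - by rewrite vl_vr; split=> [/existsP[q /andP[/eqP<- /eqP<-]]|[q <- <-]];
      [exists q|apply/existsP; exists q; rewrite !eqxx].
  - split=> [/existsP[q /andP[/eqP<- /eqP<-]]|/esym/vl_vr[q <- <-]].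
      by apply/esym/vl_vr; exists q.
    by apply/existsP; exists q; rewrite !eqxx.
  - by split=> [/eqP->//|/vr_inj->].
exists f, (fun e => match e with inl a => el g a | inr b => er g b end); split.
- apply: inj_surj_bij finj _ => v.
  by case: (vl_vr_cover g v) => -[x <-];
    [exists (glue_pi (inl x)) | exists (glue_pi (inr x))]; rewrite fE.
- apply: inj_surj_bij => [[a|b] [a'|b']|e].
  + by move/el_inj->.
  + by move/el_er.
  + by move/esym/el_er.
  + by move/er_inj->.
  by case: (el_er_cover g e) => -[x <-]; [exists (inl x) | exists (inr x)].
- by split=> -[a|b] /=; rewrite ?head_el ?head_er ?fE // ?rev_el ?rev_er.
- by move=> p; rewrite fE (inp_vl g).
- by move=> r; rewrite fE (out_vr g).
Qed.

End IOComp.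

Lemma ioiso_refl P Q (G : iograph P Q) : ioiso G G.
Proof. by exists id, id; split=> //; exists id. Qed.

Section GluingIso.

Variables P Q R : finType.

Lemma glued_iso (A : iograph P Q) (B : iograph Q R) (G G' : iograph P R) :
  glued A B G -> ioiso G G' -> glued A B G'.
Proof.
case=> -[vl vr el er eli eri eD eC vli vri vC vM hl hr rl rr iE oE].
case=> fV [fE [bV bE [hE rE] iG oG]].
have [injV injE] := (bij_inj bV, bij_inj bE).
constructor; exists (fV \o vl) (fV \o vr) (fE \o el) (fE \o er) => /=.
- exact: inj_comp.
- exact: inj_comp.
- by move=> a b /injE; apply: eD.
- move=> e; have [fE' _ E] := bE; rewrite -(E e).
  by case: (eC (fE' e)) => -[a <-]; [left|right]; exists a.
- exact: inj_comp.
- exact: inj_comp.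
- move=> v; have [fV' _ E] := bV; rewrite -(E v).
  by case: (vC (fV' v)) => -[a <-]; [left|right]; exists a.
- by move=> a b; rewrite -vM; split=> [/injV|->].
- by move=> e; rewrite hE hl.
- by move=> e; rewrite hE hr.
- by move=> e; rewrite rE rl.
- by move=> e; rewrite rE rr.
- by move=> p; rewrite iG iE.
- by move=> r; rewrite oG oE.
Qed.

Lemma glued_isor (A : iograph P Q) (B B' : iograph Q R) (G : iograph P R) :
  ioiso B' B -> glued A B G -> glued A B' G.
Proof.
move=> [fV [fE [bV bE [hE rE] iG oG]]].
case=> -[vl vr el er eli eri eD eC vli vri vC vM hl hr rl rr iE oE].
have [injV injE] := (bij_inj bV, bij_inj bE).
constructor; exists vl (vr \o fV) el (er \o fE) => //=.
- exact: inj_comp.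
- move=> e; have [fE' _ E] := bE.
  by case: (eC e) => -[a <-]; [left; exists a|right; exists (fE' a); rewrite E].
- exact: inj_comp.
- move=> v; have [fV' _ E] := bV.
  by case: (vC v) => -[a <-]; [left; exists a|right; exists (fV' a); rewrite E].
- move=> a b; rewrite vM; split=> -[q <-]; exists q => //; last by rewrite iG q0.
  by apply: injV; rewrite -iG.
- by move=> e; rewrite hr hE.
- by move=> e; rewrite rr rE.
- by move=> r; rewrite oE oG.
Qed.

Lemma gluedP (A : iograph P Q) (B : iograph Q R) (G : iograph P R) :
  glued A B G <-> ioiso (iocomp A B) G.
Proof.
split=> [[]|]; first exact: gluing_iso.
by apply: glued_iso; constructor; apply: gluing_iocomp.
Qed.

End GluingIso.

Definition opio (P Q : finType) (G : iograph P Q) : iograph Q P :=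
  IOGraph (@out_inj _ _ G) (@inp_inj _ _ G).

Lemma glued_op (P Q R : finType) (A : iograph P Q) (B : iograph Q R) G :
  glued A B G -> glued (opio B) (opio A) (opio G).
Proof.
case=> -[vl vr el er eli eri eD eC vli vri vC vM hl hr rl rr iE oE].
constructor; exists vr vl er el => //=.
- by move=> b a /esym/eD.
- by move=> e; case: (eC e); [right|left].
- by move=> v; case: (vC v); [right|left].
- by move=> b a; split=> [/esym/vM[q]|[q ? ?]]; last apply/esym/vM; exists q.
Qed.

Lemma ioiso_op (P Q : finType) (G H : iograph P Q) :
  ioiso G H -> ioiso (opio G) (opio H).
Proof. by case=> fV [fE [? ? ? ? ?]]; exists fV, fE. Qed.

(** The copies of [B] and [C] in [G] overlap exactly in the labels [R], so together they embed the
    quotient [iocomp B C]. *)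
Lemma glued_assoc (P Q R S : finType) (A : iograph P Q) (B : iograph Q R)
    (C : iograph R S) (AB : iograph P R) (G : iograph P S) :
  glued A B AB -> glued AB C G -> glued A (iocomp B C) G.
Proof.
move=> [g1] [g2].
pose h x := match x with inl b => vl g2 (vr g1 b) | inr c => vr g2 c end.
have hP b c : vl g2 (vr g1 b) = vr g2 c <-> exists2 q, out B q = b & inp C q = c.
  rewrite vl_vr; split=> -[q]; last by move=> <- <-; exists q; rewrite ?(out_vr g1).
  by rewrite (out_vr g1) => /vr_inj <- <-; exists q.
have [x y|f finj fE] := @glue_vert_lift _ _ _ B C _ h.
  case: x y => [a|b] [a'|b'] /=.
  - by split=> [/eqP->//|/vl_inj/vr_inj->].
  - by rewrite hP; split=> [/existsP[q /andP[/eqP<- /eqP<-]]|[q <- <-]];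
      [exists q|apply/existsP; exists q; rewrite !eqxx].
  - split=> [/existsP[q /andP[/eqP<- /eqP<-]]|/esym/hP[q <- <-]].
      by apply/esym/hP; exists q.
    by apply/existsP; exists q; rewrite !eqxx.
  - by split=> [/eqP->//|/vr_inj->].
constructor.
exists (vl g2 \o vl g1) f (el g2 \o el g1)
  (fun e => match e with inl b => el g2 (er g1 b) | inr c => er g2 c end) => //=.
- by apply: inj_comp; apply: el_inj.
- move=> [b|c] [b'|c'].
  + by move/el_inj/er_inj->.
  + by move/el_er.
  + by move/esym/el_er.
  + by move/er_inj->.
- by move=> a [b|c]; [move/el_inj/el_er|move/el_er].
- move=> e; case: (el_er_cover g2 e) => -[x <-]; last by right; exists (inr x).
  by case: (el_er_cover g1 x) => -[y <-]; [left; exists y|right; exists (inl y)].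
- by apply: inj_comp; apply: vl_inj.
- move=> v; case: (vl_vr_cover g2 v) => -[x <-]; last first.
    by right; exists (glue_pi (inr x)); rewrite fE.
  case: (vl_vr_cover g1 x) => -[y <-]; first by left; exists y.
  by right; exists (glue_pi (inl y)); rewrite fE.
- move=> a v; have [x <-] := glue_pi_surj v; split=> [|[q <- <-]]; last first.
    by rewrite fE /= vl_out.
  rewrite fE; case: x => [b /vl_inj|c] /=; rewrite vl_vr.
    by case=> q <- <-; exists q.
  case=> r + <-; rewrite (out_vr g1) => /esym/vl_vr[q <- qr]; exists q => //.
  rewrite /glue_inp qr; apply/glue_piP/existsP; exists r.
  by rewrite !eqxx.
- by move=> e; rewrite !head_el.
- by case=> e /=; rewrite fE /= ?head_el ?head_er.
- by move=> e; rewrite !rev_el.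
- by case=> e /=; rewrite ?rev_el ?rev_er.
- by move=> p; rewrite (inp_vl g2) (inp_vl g1).
- by move=> r; rewrite fE (out_vr g2).
Qed.

(** * Cutting a graph along a set of vertices *)

Section Split.

Variables (P Q : finType) (G : iograph P Q).
Variables (V1 V2 : {set vert G}) (E1 : {set edge G}).
Hypothesis inp1 : forall p, inp G p \in V1.
Hypothesis out2 : forall q, out G q \in V2.
Hypothesis V12 : forall v, (v \in V1) || (v \in V2).
Hypothesis E1_rev : forall e, (erev e \in E1) = (e \in E1).
Hypothesis head1 : forall e, e \in E1 -> ehead e \in V1.
Hypothesis head2 : forall e, e \notin E1 -> ehead e \in V2.

(** The middle object is the set of shared vertices itself, so the labels on both sides are
    inclusions. *)
Definition cut_vert : finType := {v : vert G | v \in V1 :&: V2}.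

Section Sub.

Variables (V : {set vert G}) (E : {set edge G}).
Hypothesis E_rev : forall e, (erev e \in E) = (e \in E).
Hypothesis headV : forall e, e \in E -> ehead e \in V.

Definition sub_vert : finType := {v : vert G | v \in V}.
Definition sub_edge : finType := {e : edge G | e \in E}.
Definition sub_head (e : sub_edge) : sub_vert := Sub (ehead (val e)) (headV (valP e)).
Definition sub_rev (e : sub_edge) : sub_edge :=
  Sub (erev (val e)) (etrans (E_rev (val e)) (valP e)).
(** Defined through the reversal, so that the axiom [ehead_rev] holds by reflexivity. *)
Definition sub_tail (e : sub_edge) : sub_vert := sub_head (sub_rev e).

Lemma sub_revK : involutive sub_rev.
Proof. by move=> e; apply: val_inj; rewrite /= erevK. Qed.

Lemma sub_rev_neq e : sub_rev e != e.
Proof. by rewrite -val_eqE /= erev_neq. Qed.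

Definition sub_graph : multigraph :=
  @Multigraph sub_vert sub_edge sub_head sub_tail sub_rev sub_revK sub_rev_neq
    (fun e => erefl).

End Sub.

Lemma E2_rev e : (erev e \in ~: E1) = (e \in ~: E1).
Proof. by rewrite !in_setC E1_rev. Qed.

Lemma headC e : e \in ~: E1 -> ehead e \in V2.
Proof. by rewrite in_setC; apply: head2. Qed.

Definition left_inp (p : P) : sub_vert V1 := Sub (inp G p) (inp1 p).
Definition left_out (m : cut_vert) : sub_vert V1 :=
  Sub (val m) (subsetP (subsetIl V1 V2) _ (valP m)).
Definition right_inp (m : cut_vert) : sub_vert V2 :=
  Sub (val m) (subsetP (subsetIr V1 V2) _ (valP m)).
Definition right_out (q : Q) : sub_vert V2 := Sub (out G q) (out2 q).

Lemma left_inp_inj : injective left_inp.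
Proof. by move=> p p' []/inp_inj. Qed.
Lemma left_out_inj : injective left_out.
Proof. by move=> p p' [] E; apply: val_inj. Qed.
Lemma right_inp_inj : injective right_inp.
Proof. by move=> p p' [] E; apply: val_inj. Qed.
Lemma right_out_inj : injective right_out.
Proof. by move=> p p' []/out_inj. Qed.

Definition split_left : iograph P cut_vert :=
  @IOGraph _ _ (sub_graph E1_rev head1) _ _ left_inp_inj left_out_inj.
Definition split_right : iograph cut_vert Q :=
  @IOGraph _ _ (sub_graph E2_rev headC) _ _ right_inp_inj right_out_inj.

Lemma glued_split : glued split_left split_right G.
Proof.
constructor; exists val val val val => //=; try exact: val_inj.
- move=> [a Ha] [b Hb] /= ab; move: Hb; rewrite -ab in_setC Ha //.
- move=> e; have [eE|eE] := boolP (e \in E1).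
    by left; exists (Sub e eE).
  by rewrite -in_setC in eE; right; exists (Sub e eE).
- move=> v; case/orP: (V12 v) => Hv; [left|right]; by exists (Sub v Hv).
- move=> a b; split=> [ab|[m <- <-] //].
  have abV : sval a \in V1 :&: V2.
    by apply/setIP; split; [exact: (valP a)|rewrite ab; exact: (valP b)].
  by exists (Sub (sval a) abV); apply: val_inj.
Qed.

End Split.

(** * Ranks of linear relations *)

Section RelationRank.

Variable F : fieldType.
Implicit Types A B C : vectType F.

(** Rank-nullity for the second projection on [T], whose kernel is a copy of [relker T]. *)
Lemma dim_relker_relim A B (T : linrel A B) :
  \dim T = (\dim (relker T) + \dim (relim T))%N.
Proof.
rewrite -(limg_ker_dim (linfun (@pair_snd F A B)) T); congr (_ + _)%N.
rewrite -(@limg_dim_eq _ _ _ (linfun (@Defs.pair_zero F A B)) (relker T)); last first.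
  apply/eqP; rewrite -subv0; apply/subvP => x /memv_capP[_].
  by rewrite memv_ker lfunE memv0 => /eqP[->].
congr (\dim _); apply/vspaceP => -[x y].
apply/memv_capP/memv_imgP => [[Txy]|[x']].
  rewrite memv_ker lfunE /= => /eqP y0; rewrite /pair_snd /= in y0.
  by subst y; exists x; [rewrite mem_relker | rewrite lfunE].
rewrite mem_relker lfunE => Tx [-> ->]; split=> //.
by rewrite memv_ker lfunE.
Qed.

Lemma dim_relswap A B (T : linrel A B) : \dim (relswap T) = \dim T.
Proof.
apply: limg_dim_eq; apply/eqP; rewrite -subv0; apply/subvP => -[x y] /memv_capP[_].
by rewrite memv_ker lfunE memv0 => /eqP[-> ->].
Qed.

Lemma relswapK A B (T : linrel A B) : relswap (relswap T) = T.
Proof. by apply/vspaceP => -[x y]; rewrite !mem_relswap. Qed.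

(** By [dim_relker_relim] the rank is the sum of the dimensions of both images minus the dimension
    of [T], which is symmetric. *)
Lemma relrank_swap A B (T : linrel A B) : relrank (relswap T) = relrank T.
Proof.
rewrite /relrank relswapK.
have := dim_relker_relim T; have := dim_relker_relim (relswap T).
rewrite dim_relswap => -> /=; lia.
Qed.

(** A predicate on three relations, so that the relation of any gluing is recognised as a composite
    directly. *)
Definition is_relcomp A B C (T1 : linrel A B) (T2 : linrel B C) (T : linrel A C) :=
  forall x z, (x, z) \in T <-> exists2 y, (x, y) \in T1 & (y, z) \in T2.

Lemma is_relcomp_swap A B C (T1 : linrel A B) (T2 : linrel B C) (T : linrel A C) :
  is_relcomp T1 T2 T -> is_relcomp (relswap T2) (relswap T1) (relswap T).
Proof.
move=> T12 z x; rewrite mem_relswap T12.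
by split=> -[y ? ?]; exists y; rewrite ?mem_relswap // -mem_relswap.
Qed.

(** Composition on the output side shrinks the domain and enlarges the kernel. *)
Lemma relrank_comp_left A B C (T1 : linrel A B) (T2 : linrel B C) T :
  is_relcomp T1 T2 T -> relrank T <= relrank T1.
Proof.
move=> T12; apply: leq_sub; apply/dimvS/subvP => x.
  case/mem_relim=> z; rewrite mem_relswap => /T12[y xy _].
  by apply/mem_relim; exists y; rewrite mem_relswap.
by rewrite !mem_relker => xy; apply/T12; exists 0%R => //; apply: mem0v.
Qed.

Lemma relrank_comp_right A B C (T1 : linrel A B) (T2 : linrel B C) T :
  is_relcomp T1 T2 T -> relrank T <= relrank T2.
Proof.
move/is_relcomp_swap/relrank_comp_left.
by rewrite !relrank_swap.
Qed.

Lemma relrank_le_codomain A B (T : linrel A B) : relrank T <= dim B.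
Proof.
rewrite -relrank_swap /relrank relswapK -dimvf.
by apply: leq_trans (leq_subr _ _) _; apply/dimvS/subvf.
Qed.

Lemma relrank_full A B (T : linrel A B) :
  relrank T = dim B -> forall y, (0%R, y) \in T -> y = 0%R.
Proof.
rewrite -relrank_swap /relrank relswapK -dimvf => rT y T0y.
have /subvP/(_ y) : (relker (relswap T) <= 0)%VS.
  rewrite subv0 -dimv_eq0; move: rT (relker_sub_im (relswap T)); rewrite relswapK.
  by have := dimvS (subvf (relim T)) => + + /dimvS; lia.
by rewrite mem_relker mem_relswap memv0 => /(_ T0y)/eqP.
Qed.

Lemma relrank_full_domain A B (T : linrel A B) :
  relrank T = dim A -> forall x, (x, 0%R) \in T -> x = 0%R.
Proof.
rewrite -relrank_swap => /relrank_full Tfull x Tx.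
by apply: Tfull; rewrite mem_relswap.
Qed.

(** The relation is the graph of a surjective linear map defined on a subspace of [A]. *)
Definition onto_function A B (T : linrel A B) :=
  (forall y, exists x, (x, y) \in T) /\ (forall y, (0%R, y) \in T -> y = 0%R).

(** Surjectivity of [T1] preserves the image of [T2], and single-valuedness preserves the set of
    values related to zero; the rank is read off from these two. *)
Lemma relrank_comp_onto_function A B C (T1 : linrel A B) (T2 : linrel B C) T :
  is_relcomp T1 T2 T -> onto_function T1 -> relrank T = relrank T2.
Proof.
move=> T12 [onto fT1]; rewrite -relrank_swap -[RHS]relrank_swap /relrank !relswapK.
suff [-> ->] : relim T = relim T2 /\ relker (relswap T) = relker (relswap T2) by [].
split; apply/vspaceP => z.
  apply/mem_relim/mem_relim => -[y]; first by case/T12=> x _; exists x.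
  by have [x xy] := onto y => yz; exists x; apply/T12; exists y.
rewrite !mem_relker !mem_relswap; apply/idP/idP => [/T12[y /fT1->]//|Tz].
by apply/T12; exists 0%R => //; apply: mem0v.
Qed.

Lemma relrank_onto_function A B (T : linrel A B) :
  onto_function T -> relrank T = dim B.
Proof.
case=> onto fT; rewrite -relrank_swap /relrank relswapK.
have /eqP-> : relker (relswap T) == 0%VS.
  rewrite -subv0; apply/subvP => y; rewrite mem_relker mem_relswap memv0.
  by move/fT->.
rewrite dimv0 subn0 -dimvf; congr (\dim _); apply/vspaceP => y; rewrite memvf.
by apply/mem_relim/onto.
Qed.

Lemma dim_bdata (P : finType) : dim (bdata F P) = 2 * #|P|.
Proof.
have -> : dim (bdata F P) = (#|P| * 1 + #|P| * 1)%N by [].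
by lia.
Qed.

End RelationRank.

(** * Boundary behaviour under composition *)

Lemma sum_fiber (V : nmodType) (I J : finType) (P : pred J) (h : I -> J)
    (f : I -> V) :
  (\sum_(a | P a) \sum_(q | h q == a) f q = \sum_(q | P (h q)) f q)%R.
Proof.
rewrite (exchange_big_dep (fun q => P (h q))) => [|a q Pa /eqP->] //=.
apply: eq_bigr => q Pq; rewrite (big_pred1 (h q)) // => a /=.
by rewrite eq_sym; case: eqP => [->|]; rewrite ?Pq ?andbF.
Qed.

Section PullNetwork.

Local Open Scope ring_scope.

Variables (F : fieldType) (H G : multigraph) (f : edge H -> edge G).
Hypothesis f_inj : injective f.
Hypothesis f_rev : forall e, erev (f e) = f (erev e).

Definition pull_network (w : network F G) : network F H :=
  @Network F H (fun e => weight w (f e)) (fun e => weight_neq0 w (f e))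
    (fun e => etrans (congr1 (weight w) (esym (f_rev e))) (weight_rev w (f e))).

(** Extends weights along an embedding, with the nonzero default 1 off the image, so that every
    network on a factor comes from one on the composite. *)
Definition push_weight (w : network F H) (e : edge G) : F :=
  if [pick a | f a == e] is Some a then weight w a else 1.

Lemma push_weightE w e : push_weight w (f e) = weight w e.
Proof.
rewrite /push_weight; case: pickP => [a /eqP/f_inj->//|/(_ e)].
by rewrite eqxx.
Qed.

Lemma push_weight_neq0 w e : push_weight w e != 0.
Proof.
by rewrite /push_weight; case: pickP => *; rewrite ?oner_neq0 ?weight_neq0.
Qed.

Lemma push_weight_rev w e : push_weight w (erev e) = push_weight w e.
Proof.
rewrite {2}/push_weight; case: pickP => [a /eqP<-|none].
  by rewrite f_rev push_weightE weight_rev.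
rewrite /push_weight; case: pickP => // a /eqP ae.
by have := none (erev a); rewrite -f_rev ae erevK eqxx.
Qed.

Definition push_network (w : network F H) : network F G :=
  Network (push_weight_neq0 w) (push_weight_rev w).

End PullNetwork.

Section Behaviour.

Local Open Scope ring_scope.

Variable F : fieldType.

Lemma laplacian_weight (G : multigraph) (w w' : network F G) u v :
  weight w =1 weight w' -> laplacian w u v = laplacian w' u v.
Proof. by move=> ww'; apply: eq_bigr => e _; rewrite ww'. Qed.

Lemma Xrel_weight (P Q : finType) (G : iograph P Q) (w w' : network F G) z :
  weight w =1 weight w' -> (z \in Xrel w) = (z \in Xrel w').
Proof.
move=> ww'; apply/mem_Xrel/mem_Xrel => -[u [? ? L]]; exists u; split=> // v.
  by rewrite -(laplacian_weight _ _ ww').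
by rewrite (laplacian_weight _ _ ww').
Qed.

Lemma etail_head_rev (G : multigraph) (e : edge G) : etail e = ehead (erev e).
Proof. by rewrite ehead_rev. Qed.

Section Gluing.

Variables (P Q R : finType) (A : iograph P Q) (B : iograph Q R) (G : iograph P R).
Variable g : gluing A B G.

Definition pull_l := pull_network (F := F) (rev_el g).
Definition pull_r := pull_network (F := F) (rev_er g).

Lemma big_edges_glue (V : nmodType) (p : pred (edge G)) (f : edge G -> V) :
  \sum_(e | p e) f e =
  \sum_(a | p (el g a)) f (el g a) + \sum_(b | p (er g b)) f (er g b).
Proof.
pose h (e : edge A + edge B) := match e with inl a => el g a | inr b => er g b end.
rewrite (reindex h) /=; first by rewrite big_sumType.
apply/onW_bij/inj_surj_bij => [[a|b] [a'|b']|e].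
- by move/el_inj->.
- by move/el_er.
- by move/esym/el_er.
- by move/er_inj->.
by case: (el_er_cover g e) => -[x <-]; [exists (inl x) | exists (inr x)].
Qed.

Lemma laplacian_glue (w : network F G) (u : {ffun vert G -> F^o}) v :
  laplacian w u v =
    \sum_(a | vl g a == v) laplacian (pull_l w) [ffun a => u (vl g a)] a +
    \sum_(b | vr g b == v) laplacian (pull_r w) [ffun b => u (vr g b)] b.
Proof.
rewrite /laplacian big_edges_glue; congr (_ + _).
  rewrite (sum_fiber (fun a => vl g a == v)) /=.
  apply: eq_big => [a|a _]; first by rewrite head_el.
  by rewrite !etail_head_rev rev_el !head_el !ffunE.
rewrite (sum_fiber (fun a => vr g a == v)) /=.
apply: eq_big => [a|a _]; first by rewrite head_er.
by rewrite !etail_head_rev rev_er !head_er !ffunE.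
Qed.

(** The Laplacian of a glued graph is the sum of those of its two parts, so the equation at a shared
    vertex says that the current leaving one part enters the other. *)
Lemma Xrel_glue (w : network F G) :
  is_relcomp (Xrel (pull_l w)) (Xrel (pull_r w)) (Xrel w).
Proof.
move=> x z; split.
  case/mem_Xrel=> u [/= ux uz uv].
  pose ul := [ffun a => u (vl g a)] : {ffun vert A -> F^o}.
  pose ur := [ffun b => u (vr g b)] : {ffun vert B -> F^o}.
  pose c1 := [ffun q => u (vl g (out A q))] : {ffun Q -> F^o}.
  (* The current that the equation of [A] forces at its outputs; the equation of [B] then follows by
     subtraction. *)
  pose c2 := [ffun q => laplacian (pull_l w) ul (out A q)
    + \sum_(p | inp A p == out A q) x.2 p] : {ffun Q -> F^o}.
  have uvl a : laplacian w u (vl g a) = laplacian (pull_l w) ul a +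
      \sum_(b | vr g b == vl g a) laplacian (pull_r w) ur b.
    rewrite laplacian_glue (big_pred1 a) // => a' /=.
    by rewrite (inj_eq (@vl_inj _ _ _ _ _ _ g)).
  have uvr b : laplacian w u (vr g b) =
      \sum_(a | vl g a == vr g b) laplacian (pull_l w) ul a +
      laplacian (pull_r w) ur b.
    rewrite laplacian_glue; congr (_ + _); rewrite (big_pred1 b) // => b' /=.
    by rewrite (inj_eq (@vr_inj _ _ _ _ _ _ g)).
  have inpE p a : (inp G p == vl g a) = (inp A p == a).
    by rewrite (inp_vl g) (inj_eq (@vl_inj _ _ _ _ _ _ g)).
  have outE r b : (out G r == vr g b) = (out B r == b).
    by rewrite (out_vr g) (inj_eq (@vr_inj _ _ _ _ _ _ g)).
  exists (c1, c2); apply/mem_Xrel.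
    exists ul; split=> [p|q|a] /=; rewrite ?ffunE //.
      by rewrite -ux (inp_vl g).
    have [q /eqP <-|nq] := pickP [pred q | out A q == a].
      rewrite (big_pred1 q) => [|q'] /=; last by rewrite (inj_eq (@out_inj _ _ A)).
      by rewrite !ffunE; ring.
    rewrite big_pred0 // sub0r; have := uvl a.
    rewrite uv big_pred0 => [|r]; last first.
      apply/eqP; rewrite (out_vr g) => /esym/vl_vr[q aq _].
      by have := nq q; rewrite /= aq eqxx.
    rewrite [X in _ = _ + X]big_pred0 => [|b]; last first.
      apply/eqP => /esym/vl_vr[q aq _].
      by have := nq q; rewrite /= aq eqxx.
    by rewrite sub0r addr0 => <-; congr (- _); apply: eq_bigl => p; rewrite inpE.
  exists ur; split=> [q|r|b] /=; rewrite ?ffunE ?vl_out //.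
    by rewrite -uz (out_vr g).
  have [q /eqP <-|nq] := pickP [pred q | inp B q == b].
    rewrite [X in _ - X](big_pred1 q) => [|q'] /=; last by rewrite (inj_eq (@inp_inj _ _ B)).
    have := uvr (inp B q); rewrite uv (eq_bigl (fun r => out B r == inp B q)) //.
    rewrite -vl_out (big_pred1 (out A q)); last first.
      by move=> a; rewrite /= (inj_eq (@vl_inj _ _ _ _ _ _ g)).
    rewrite [X in _ - X = _](eq_bigl (fun p => inp A p == out A q)) // !ffunE => E.
    by apply: (addrI (laplacian (pull_l w) ul (out A q))); rewrite -E; ring.
  rewrite [X in _ - X]big_pred0 // subr0; have := uvr b.
  rewrite uv [X in _ - X]big_pred0 => [|p]; last first.
    apply/eqP; rewrite (inp_vl g) => /vl_vr[q _ bq].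
    by have := nq q; rewrite /= bq eqxx.
  rewrite [X in _ = X + _]big_pred0 => [|a]; last first.
    apply/eqP => /vl_vr[q _ bq].
    by have := nq q; rewrite /= bq eqxx.
  by rewrite subr0 add0r => <-; apply: eq_bigl => r; rewrite outE.
case=> -[c1 c2] /mem_Xrel[ul [/= lx lc lv]] /mem_Xrel[ur [/= rc rz rv]].
(* On shared vertices [ul] and [ur] agree; the default 0 is never reached, since the two parts cover
   [G]. *)
pose u := [ffun v => if [pick a | vl g a == v] is Some a then ul a
  else if [pick b | vr g b == v] is Some b then ur b else 0] : {ffun vert G -> F^o}.
have ulE a : u (vl g a) = ul a.
  rewrite ffunE; case: pickP => [a' /eqP/vl_inj->//|/(_ a)].
  by rewrite eqxx.
have urE b : u (vr g b) = ur b.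
  rewrite ffunE; case: pickP => [a' /eqP/vl_vr[q <- <-]|_].
    by rewrite lc rc.
  case: pickP => [a' /eqP/vr_inj->//|/(_ b)].
  by rewrite eqxx.
apply/mem_Xrel; exists u; split=> /= [p|r|v].
- by rewrite (inp_vl g) ulE.
- by rewrite (out_vr g) urE.
rewrite laplacian_glue.
have -> : [ffun a => u (vl g a)] = ul by apply/ffunP => a; rewrite ffunE.
have -> : [ffun b => u (vr g b)] = ur by apply/ffunP => a; rewrite ffunE.
rewrite (eq_bigr _ (fun a _ => lv a)) (eq_bigr _ (fun a _ => rv a)) !sumrB.
rewrite !(sum_fiber (fun a => vl g a == v)) !(sum_fiber (fun a => vr g a == v)) /=.
rewrite (eq_bigl (fun q => vr g (inp B q) == v)) => [|q]; last by rewrite vl_out.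
rewrite addrC addrA subrK; congr (_ - _); apply: eq_bigl => k.
  by rewrite (out_vr g).
by rewrite (inp_vl g).
Qed.

End Gluing.

(** Exchanging inputs and outputs reverses the sign convention for the currents. *)
Lemma Xrel_op (P Q : finType) (G : iograph P Q) (w : network F G) x1 x2 y1 y2 :
  (((y1, y2), (x1, x2)) \in Xrel (G := opio G) w) =
  (((x1, - x2), (y1, - y2)) \in Xrel w).
Proof.
have sumN (I : finType) (p : pred I) (f : {ffun I -> F^o}) :
    \sum_(i | p i) (- f) i = - \sum_(i | p i) f i.
  by rewrite -sumrN; apply: eq_bigr => i _; rewrite ffunE.
apply/mem_Xrel/mem_Xrel => -[u [/= uy ux uv]]; exists u; split=> //= v;
  by rewrite uv !sumN opprK addrC.
Qed.

Lemma Xrel_iso (P Q : finType) (G H : iograph P Q) (w : network F H) :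
  ioiso G H -> exists w' : network F G, Xrel w' = Xrel w.
Proof.
case=> fV [fE [bV bE [hE rE] iE oE]].
have [injV injE] := (bij_inj bV, bij_inj bE).
exists (pull_network rE w).
have lapE (u : {ffun vert H -> F^o}) v : laplacian (pull_network rE w)
    [ffun v => u (fV v)] v = laplacian w u (fV v).
  rewrite /laplacian [RHS](reindex fE) /=; last exact: onW_bij.
  apply: eq_big => [e|e _]; first by rewrite hE (inj_eq injV).
  by rewrite !ffunE !etail_head_rev rE !hE.
have inpE p v : (inp H p == fV v) = (inp G p == v) by rewrite iE (inj_eq injV).
have outE q v : (out H q == fV v) = (out G q == v) by rewrite oE (inj_eq injV).
have [gV gK fK] := bV.
apply/vspaceP => z; apply/mem_Xrel/mem_Xrel => -[u [uP uQ uv]].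
  exists [ffun v => u (gV v)]; split=> [p|q|v]; rewrite ?ffunE ?iE ?oE ?gK //.
  rewrite -[v]fK -lapE; rewrite (_ : [ffun _ => _] = u) ?uv.
    by congr (_ - _); apply: eq_bigl => k; rewrite ?inpE ?outE.
  by apply/ffunP => k; rewrite !ffunE gK.
exists [ffun v => u (fV v)]; split=> [p|q|v]; rewrite ?ffunE -?iE -?oE //.
by rewrite lapE uv; congr (_ - _); apply: eq_bigl => k; rewrite ?inpE ?outE.
Qed.

End Behaviour.

(** * Separations and the rank of a factorization *)

Definition io_separation (P Q : finType) (G : iograph P Q) (L R : {set vert G}) :=
  separation (@adj G) (@is_input _ _ G) (@is_output _ _ G) L R.

Section Adjacency.

Variable G : multigraph.

Lemma adj_head (e : edge G) : adj (etail e) (ehead e).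
Proof. by apply/existsP; exists e; rewrite !eqxx. Qed.

Lemma etail_rev (e : edge G) : etail (erev e) = ehead e.
Proof. by rewrite etail_head_rev erevK. Qed.

Lemma adj_sym : symmetric (@adj G).
Proof.
move=> x y; apply/existsP/existsP => -[e /andP[/eqP<- /eqP<-]];
  by exists (erev e); rewrite etail_rev ehead_rev !eqxx.
Qed.

Lemma component_head (v : vert G) (e : edge G) :
  (ehead e \in component v) = (etail e \in component v).
Proof.
rewrite !inE; apply/idP/idP => h; apply: connect_trans h (connect1 _).
  by rewrite adj_sym adj_head.
exact: adj_head.
Qed.

Lemma mem_component (v : vert G) : v \in component v.
Proof. by rewrite inE connect0. Qed.

End Adjacency.

Section Separations.

Variables (P Q : finType) (G : iograph P Q).

Lemma is_inputP v : reflect (exists p, inp G p = v) (is_input v).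
Proof. by apply: (iffP codomP) => -[p E]; exists p. Qed.

Lemma is_outputP v : reflect (exists q, out G q = v) (is_output v).
Proof. by apply: (iffP codomP) => -[p E]; exists p. Qed.

Lemma is_input_inp p : is_input (inp G p).
Proof. exact: codom_f. Qed.

Lemma is_output_out q : is_output (out G q).
Proof. exact: codom_f. Qed.

Lemma io_separationP (L R : {set vert G}) :
  reflect [/\ forall p, inp G p \in L, forall q, out G q \in R,
              forall x, (x \in L) || (x \in R) &
              forall e : edge G, etail e \notin R -> ehead e \in L]
    (io_separation L R).
Proof.
apply: (iffP (separationP _ _ _ _ _)) => -[hA hB cov sep]; split=> //.
- by move=> p; apply: hA; apply: codom_f.
- by move=> q; apply: hB; apply: codom_f.
- by move=> e eR; apply: contraTT (adj_head e); apply: sep.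
- by move=> v /is_inputP[p <-].
- by move=> v /is_outputP[p <-].
- move=> x y xR yL; apply/existsP => -[e /andP[/eqP ex /eqP ey]].
  by case/negP: yL; rewrite -ey sep // ex.
Qed.

(** Each path meets the separator, and disjoint paths meet it in distinct vertices. *)
Lemma max_paths_le (L R : {set vert G}) :
  io_separation L R -> max_paths G <= #|L :&: R|.
Proof.
move=> sep; apply/bigmax_leqP => S /andP[/forall_inP lS /forall_inP dS].
pose f (s : #|vert G|.-bseq (vert G)) := [pick v in s | v \in L :&: R].
have fP s : s \in S -> exists v, [/\ f s = Some v, v \in s & v \in L :&: R].
  move=> /lS; rewrite /io_path => ls.
  have [|v vs vLR] := linking_meets_separation sep (s := s) _; first by case: (s : seq _) ls.
  rewrite /f; case: pickP => [x /andP[xs xLR]|/(_ v)]; first by exists x.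
  by rewrite vs vLR.
have finj : {in S &, injective f}.
  move=> s t sS tS; have [v [-> vs _]] := fP s sS; have [v' [-> vt _]] := fP t tS.
  case=> vv'; rewrite -vv' in vt; apply/eqP; apply: contraT => nst.
  have /forall_inP/(_ t tS)/implyP/(_ nst) := dS s sS.
  by rewrite disjoint_has => /hasPn/(_ v vs); rewrite /= vt.
have some_inj : injective (@Some (vert G)) by move=> ? ? [].
rewrite -(card_in_imset finj) -(card_imset _ some_inj).
apply/subset_leq_card/subsetP => _ /imsetP[s sS ->].
by have [v [-> _ vLR]] := fP s sS; apply/imsetP; exists v.
Qed.

(** By Menger's theorem a separation of least order is matched by that many disjoint paths. *)
Lemma max_paths_separation :
  exists L R : {set vert G}, io_separation L R /\ #|L :&: R| = max_paths G.
Proof.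
have sep0 : io_separation [set: vert G] [set v | is_output v].
  by apply/io_separationP; split=> *; rewrite ?inE // is_output_out.
pose D := [pred q : {set vert G} * {set vert G} | io_separation q.1 q.2].
case: (@arg_minnP _ (setT, [set v | is_output v]) D (fun q => #|q.1 :&: q.2|) sep0).
move=> [L R] /= sep Lmin; exists L, R; split=> //.
apply/eqP; rewrite eqn_leq max_paths_le // andbT.
have [L' R' sep'|p [lp dp]] := @menger _ (@adj G) (@is_input _ _ G) (@is_output _ _ G) #|L :&: R|.
  by apply: (Lmin (L', R')).
have /fin_all_exists[b bE] i : exists b : #|vert G|.-bseq (vert G), b = p i :> seq _.
  have sz : size (p i) <= #|vert G|.
    case: (p i) (lp i) => // x s /and5P[_ /card_uniqP us _ _ _].
    by rewrite -us max_card.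
  by exists (Bseq sz).
have binj : injective b.
  move=> i j bij; have pij : p i = p j by rewrite -!bE bij.
  have := dp i j; rewrite -pij; case: (p i) (lp i) => // x s _ /(_ x).
  by apply; rewrite inE eqxx.
rewrite -[X in X <= _]card_ord -(card_imset _ binj).
apply: (leq_bigmax_cond (F := fun S : {set _} => #|S|)).
apply/andP; split.
  apply/forall_inP => _ /imsetP[i _ ->]; rewrite bE /io_path.
  by case: (p i) (lp i).
apply/forall_inP => _ /imsetP[i _ ->]; apply/forall_inP => _ /imsetP[j _ ->].
apply/implyP => nij; rewrite disjoint_has; apply/hasPn => v /=; rewrite !bE => vi.
by apply: contra nij => vj; rewrite (dp i j v).
Qed.

(** Edges with both ends in [L] go to the left factor. Any other edge has both ends in [R], because
    the neighbours of a vertex outside [R] lie in [L]. *)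
Lemma io_separation_glued (L R : {set vert G}) : io_separation L R ->
  exists M (A : iograph P M) (B : iograph M Q), glued A B G /\ #|M| = #|L :&: R|.
Proof.
case/io_separationP=> hA hB cov sep.
pose E1 := [set e : edge G | (ehead e \in L) && (etail e \in L)].
have E1rev e : (erev e \in E1) = (e \in E1).
  by rewrite !inE ehead_rev etail_rev andbC.
have E1L e : e \in E1 -> ehead e \in L by rewrite inE => /andP[].
have E1R e : e \notin E1 -> ehead e \in R.
  rewrite inE negb_and; case/orP=> [eL|eL]; first by move: (cov (ehead e)); rewrite (negbTE eL).
  by apply: contraNT eL => eR; rewrite -ehead_rev sep // etail_rev.
exists (cut_vert L R), (split_left R hA E1rev E1L), (split_right L hB E1rev E1R).
by split; [apply: glued_split | rewrite card_sig; apply: eq_card => v; rewrite inE].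
Qed.

(** The relation factors through the boundary data on the separator, which have a potential and a
    current for each vertex. *)
Lemma relrank_le_separation (F : fieldType) (w : network F G) (L R : {set vert G}) :
  io_separation L R -> relrank (Xrel w) <= 2 * #|L :&: R|.
Proof.
case/io_separation_glued=> M [A [B [[g] <-]]].
apply: leq_trans (relrank_comp_left (Xrel_glue g w)) _.
by rewrite -(dim_bdata F); apply: relrank_le_codomain.
Qed.

Lemma relrank_le_max_paths (F : fieldType) (w : network F G) :
  relrank (Xrel w) <= 2 * max_paths G.
Proof.
by have [L [R [sep <-]]] := max_paths_separation; apply: relrank_le_separation.
Qed.

End Separations.


(* The orientation given by the enumeration of the edges makes this work in
   characteristic 2. *)
Lemma antisym_sum0 (V : zmodType) (G : multigraph) (p : pred (edge G))
    (f : edge G -> V) :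
  (forall e, p (erev e) = p e) -> (forall e, f (erev e) = - f e)%R ->
  (\sum_(e | p e) f e = 0)%R.
Proof.
move=> prev frev; pose o (e : edge G) := (enum_rank e < enum_rank (erev e))%N.
have orev e : o (erev e) = ~~ o e.
  rewrite /o erevK ltnNge leq_eqVlt negb_or -ltnNge.
  have : enum_rank (erev e) != enum_rank e by rewrite (inj_eq enum_rank_inj) erev_neq.
  by rewrite -val_eqE /= eq_sym => ->.
rewrite (bigID o) /= [X in (_ + X)%R](reindex_inj (inv_inj (@erevK G))) /=.
rewrite [X in (_ + X)%R](eq_big (fun e => p e && o e) (fun e => - f e)%R) => [|e|e _].
- by rewrite sumrN subrr.
- by rewrite prev orev negbK.
- by rewrite frev.
Qed.

(** * Elementary factors as surjective partial functions *)

Section LeftGood.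

Local Open Scope ring_scope.

Variable F : fieldType.

Section Graph.

Variables (P Q : finType) (G : iograph P Q) (w : network F G).
Implicit Types u : {ffun vert G -> F^o}.

Lemma sum_out (q : Q) (f : Q -> F) : \sum_(q' | out G q' == out G q) f q' = f q.
Proof. by rewrite (big_pred1 q) // => q'; rewrite /= (inj_eq (@out_inj _ _ G)). Qed.

Lemma sum_inp (p : P) (f : P -> F) : \sum_(p' | inp G p' == inp G p) f p' = f p.
Proof. by rewrite (big_pred1 p) // => q'; rewrite /= (inj_eq (@inp_inj _ _ G)). Qed.

Lemma sum_not_output (v : vert G) (f : Q -> F) :
  ~~ is_output v -> \sum_(q | out G q == v) f q = 0.
Proof. by move=> nv; apply: big_pred0 => q; apply: contraNF nv => /eqP<-; apply: codom_f. Qed.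

Lemma sum_not_input (v : vert G) (f : P -> F) :
  ~~ is_input v -> \sum_(p | inp G p == v) f p = 0.
Proof. by move=> nv; apply: big_pred0 => q; apply: contraNF nv => /eqP<-; apply: codom_f. Qed.

(** The input data are free: potentials are read off from [u] and currents are solved for, so the
    Laplace equation only constrains [u] at the other vertices. *)
Lemma Xrel_onto (y : bdata F Q) u :
  (forall q, u (out G q) = y.1 q) ->
  (forall v, ~~ is_input v -> laplacian w u v = \sum_(q | out G q == v) y.2 q) ->
  exists x, (x, y) \in Xrel w.
Proof.
move=> u1 u2; exists ([ffun p => u (inp G p)],
  [ffun p => \sum_(q | out G q == inp G p) y.2 q - laplacian w u (inp G p)]).
apply/mem_Xrel; exists u; split=> //= [p|v]; first by rewrite ffunE.
have [/is_inputP[p <-]|nv] := boolP (is_input v); last first.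
  by rewrite u2 // sum_not_input // subr0.
by rewrite (sum_inp p) ffunE opprB addrC subrK.
Qed.

Lemma mem_Xrel_0l (y : bdata F Q) :
  (0, y) \in Xrel w <-> exists u, [/\ forall v, is_input v -> u v = 0,
    forall v, ~~ is_output v -> laplacian w u v = 0,
    forall q, y.1 q = u (out G q) & forall q, y.2 q = laplacian w u (out G q)].
Proof.
have zero_sum (v : vert G) : \sum_(p | inp G p == v) (0 : {ffun P -> F^o}) p = 0.
  by rewrite big1 // => p _; rewrite ffunE.
split=> [/mem_Xrel[u [/= ux uy uv]]|[u [ux uv uy1 uy2]]].
  exists u; split=> [v /is_inputP[p <-]|v nv|q|q].
  - by rewrite ux ffunE.
  - by rewrite uv zero_sum sum_not_output // subr0.
  - by rewrite uy.
  - by rewrite uv zero_sum sum_out subr0.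
apply/mem_Xrel; exists u; split=> /= [p|q|v].
- by rewrite ux ?ffunE //; apply: codom_f.
- by rewrite uy1.
rewrite zero_sum subr0; have [/is_outputP[q <-]|nv] := boolP (is_output v).
  by rewrite sum_out uy2.
by rewrite uv // sum_not_output.
Qed.

Lemma Xrel_function0 :
  (forall u, (forall v, is_input v -> u v = 0) ->
     (forall v, ~~ is_output v -> laplacian w u v = 0) ->
     forall v, is_output v -> u v = 0 /\ laplacian w u v = 0) ->
  forall y, (0, y) \in Xrel w -> y = 0.
Proof.
move=> h [y1 y2] /mem_Xrel_0l[u [/= ux uv uy1 uy2]].
by congr (_, _); apply/ffunP => q; rewrite ffunE ?uy1 ?uy2;
  case: (h u ux uv (out G q) (codom_f _ q)).
Qed.

(** The contributions of an edge and of its reverse cancel. *)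
Lemma sum_laplacian_component u v : \sum_(x in component v) laplacian w u x = 0.
Proof.
rewrite (sum_fiber (fun x => x \in component v)); apply: antisym_sum0 => e.
  by rewrite ehead_rev component_head.
by rewrite weight_rev ehead_rev etail_rev -mulrN opprB.
Qed.

(** The outputs prescribe the whole potential and every vertex absorbs current as an input; zero
    input potentials force [u] to vanish everywhere. *)
Lemma onto_function_type2 : type2 G -> onto_function (Xrel w).
Proof.
move=> G2; split=> [y|].
  pose u := [ffun v => if [pick q | out G q == v] is Some q then y.1 q else 0] : {ffun vert G -> F^o}.
  apply: (Xrel_onto (u := u)) => [q|v]; last by case/andP: (G2 v) => ->.
  by rewrite ffunE; case: pickP => [q' /eqP/out_inj->//|/(_ q)]; rewrite eqxx.
apply: Xrel_function0 => u ux _ v _.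
have u0 x : u x = 0 by apply: ux; case/andP: (G2 x).
by split; rewrite // /laplacian big1 // => e _; rewrite !u0 subrr mulr0.
Qed.

(** Onto: the potential is constant on each component, with the value at its only output.
    Single-valued: the Laplacian sums to zero over a component and vanishes off the output, hence at
    the output too. *)
Lemma onto_function_type3' : type3' G -> onto_function (Xrel w).
Proof.
case=> [oi sep]; have sep' q q' : out G q' \in component (out G q) -> q' = q.
  move=> cq; apply: (@out_inj _ _ G); apply/eqP; apply: contraT => nq.
  have /eqP[] := sep _ _ (codom_f _ q') (codom_f _ q) nq.
  apply/setP => x; rewrite !inE; move: cq; rewrite inE => /same_connect -> //.
  exact/sym_connect_sym/adj_sym.
split=> [y|].
  pose u := [ffun v => if [pick q | out G q \in component v] is Some q then y.1 q else 0] : {ffun vert G -> F^o}.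
  apply: (Xrel_onto (u := u)) => [q|v].
    by rewrite ffunE; case: pickP => [q' /sep'->//|/(_ q)]; rewrite mem_component.
  move=> nv; rewrite sum_not_output; last by apply: contra nv => /oi.
  rewrite /laplacian big1 // => e _; rewrite !ffunE.
  rewrite (eq_pick (_ : _ =1 (fun q => out G q \in component (etail e)))) ?subrr ?mulr0 // => q.
  rewrite !inE; apply: same_connect; first exact/sym_connect_sym/adj_sym.
  by apply: connect1; rewrite adj_sym adj_head.
apply: Xrel_function0 => u ux uv _ /is_outputP[q <-]; split.
  by apply: ux; apply: oi; apply: codom_f.
have := sum_laplacian_component u (out G q).
rewrite (bigD1 (out G q)) ?mem_component //= big1 ?addr0 // => x /andP[xK nx].
by apply: uv; apply: contra nx => /is_outputP[q' Eq]; move: xK; rewrite -Eq => /sep'->.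
Qed.

(** Turns the description by components into conditions on the edges at a vertex, which is what the
    Laplacian sees. *)
Lemma type1_output (v : vert G) : type1 G -> is_output v ->
  is_input v /\ (forall e : edge G, ehead e != v) \/
  exists e : edge G, [/\ ehead e = v, is_input (etail e) && ~~ is_output (etail e),
    ~~ is_input v, forall e' : edge G, ehead e' = v -> e' = e &
    forall e' : edge G, ehead e' = etail e -> e' = erev e].
Proof.
move=> /(_ v)[[_ E0 iv _] _|[e [ne cE cEe iO oI]] ov].
  left; split=> // e; apply/eqP => ev; have := in_set0 e.
  by rewrite -E0 inE ev mem_component.
right; exists e; case/andP: (oI) => [_ nI].
have vh : ehead e = v.
  have := mem_component v; rewrite cE !inE => /orP[]/eqP vE //.
  by move: iO; rewrite -vE ov andbF.
have edgeE e' : ehead e' \in component v -> e' = e \/ e' = erev e.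
  move=> e'v; have : e' \in component_edges v by rewrite inE.
  by rewrite cEe !inE => /orP[]/eqP; [left|right].
split=> //; first by rewrite -vh.
- move=> e' e'v; have [|//|e'e] := edgeE e'; first by rewrite e'v mem_component.
  by move: ne; rewrite -ehead_rev -e'e e'v vh eqxx.
- move=> e' e't; have [|e'e|//] := edgeE e'; first by rewrite e't cE !inE eqxx.
  by move: ne; rewrite -e't e'e eqxx.
Qed.

Lemma type1_io (v : vert G) : type1 G -> is_input v || is_output v.
Proof.
move=> /(_ v)[[_ _ -> //]|[e [_ cE _ /andP[iI _] /andP[oO _]]]].
by have := mem_component v; rewrite cE !inE => /orP[]/eqP->; rewrite ?iI ?oO ?orbT.
Qed.

Lemma laplacian1 u (v : vert G) (e : edge G) : ehead e = v ->
  (forall e' : edge G, ehead e' = v -> e' = e) ->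
  laplacian w u v = weight w e * (u v - u (etail e)).
Proof.
move=> ev uniq_e; rewrite /laplacian (big_pred1 e) ?ev // => e' /=.
by apply/eqP/eqP => [/uniq_e|->].
Qed.

Lemma onto_function_type1 : type1 G -> onto_function (Xrel w).
Proof.
move=> G1; split=> [y|].
  (* The potential at the input end of an edge is solved from the equation at the output end, where
     current and potential are given. *)
  pose u := [ffun v => if [pick q | out G q == v] is Some q then y.1 q else
    if [pick e : edge G | etail e == v] is Some e then
      if [pick q | out G q == ehead e] is Some q then y.1 q - y.2 q / weight w e else 0
    else 0] : {ffun vert G -> F^o}.
  have uo q : u (out G q) = y.1 q.
    by rewrite ffunE; case: pickP => [q' /eqP/out_inj->//|/(_ q)]; rewrite eqxx.
  apply: (Xrel_onto (u := u)) => // v nv.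
  have ov : is_output v by have := type1_io v G1; rewrite (negbTE nv).
  have [[]|[e [ev iO _ ue ut]]] := type1_output G1 ov; first by rewrite (negbTE nv).
  have /is_outputP[q qv] := ov.
  rewrite (laplacian1 _ ev ue) -qv sum_out uo.
  suff -> : u (etail e) = y.1 q - y.2 q / weight w e.
    by rewrite opprB addrC subrK mulrC divfK // weight_neq0.
  rewrite ffunE; case: pickP => [q' /eqP q'e|_].
    by case/andP: iO => _ /is_outputP[]; exists q'.
  case: pickP => [e' /eqP e't|/(_ e)]; last by rewrite eqxx.
  have -> : e' = e by apply: (inv_inj (@erevK G)); apply: ut; rewrite ehead_rev.
  case: pickP => [q' /eqP|/(_ q)]; last by rewrite qv ev eqxx.
  by rewrite ev -qv => /out_inj->.
apply: Xrel_function0 => u ux uv v ov.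
have [[iv ne]|[e [ev /andP[iI iO] _ ue ut]]] := type1_output G1 ov.
  by split; [apply: ux | rewrite /laplacian big_pred0 // => e; apply: negbTE].
have := uv _ iO; rewrite (laplacian1 _ _ ut) ?ehead_rev // etail_rev (ux _ iI) sub0r.
move/eqP; rewrite mulf_eq0 (negbTE (weight_neq0 _ _)) oppr_eq0 /= ev => /eqP uv0.
by split=> //; rewrite (laplacian1 _ ev ue) uv0 (ux _ iI) subrr mulr0.
Qed.

Lemma onto_function_left t : has_type t G -> t <> Type4' -> onto_function (Xrel w).
Proof.
by case: t => //= ? _; [apply: onto_function_type1 | apply: onto_function_type2
  | apply: onto_function_type3'].
Qed.

End Graph.

Definition opposite_type t :=
  match t with Type3' => Type4' | Type4' => Type3' | _ => t end.

Lemma has_type_op (P Q : finType) (G : iograph P Q) t :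
  has_type t G -> has_type (opposite_type t) (opio G).
Proof.
case: t => //= h v; last by rewrite andbC; apply: h.
case: (h v) => [[? ? ? ?]|[e [ne cE cEe iO oI]]]; [by left|right].
exists (erev e); rewrite etail_rev ehead_rev erevK; split=> //.
- by rewrite eq_sym.
- by rewrite cE setUC.
- by rewrite cEe setUC.
Qed.

Lemma onto_function_swap (P Q : finType) (G : iograph P Q) (w : network F G) :
  onto_function (Xrel (G := opio G) w) -> onto_function (relswap (Xrel w)).
Proof.
case=> onto inj; split=> [[x1 x2]|[x1 x2]].
  have [[y1 y2]] := onto (x1, - x2); rewrite Xrel_op opprK => xy.
  by exists (y1, - y2); rewrite mem_relswap.
rewrite mem_relswap => x0; have := inj (x1, - x2).
rewrite -[0 in X in X -> _]/(0, 0) Xrel_op opprK oppr0 => /(_ x0)[-> /eqP].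
by rewrite oppr_eq0 => /eqP->.
Qed.

Lemma onto_function_right (P Q : finType) (G : iograph P Q) (w : network F G) t :
  has_type t G -> t <> Type3' -> onto_function (relswap (Xrel w)).
Proof.
move=> /has_type_op tG nt; apply/onto_function_swap/(onto_function_left _ tG).
by case: t nt tG.
Qed.

Lemma onto_function_comp (A B C : vectType F) (T1 : linrel A B) (T2 : linrel B C) T :
  is_relcomp T1 T2 T -> onto_function T1 -> onto_function T2 -> onto_function T.
Proof.
move=> T12 [o1 f1] [o2 f2]; split=> [z|z /T12[y /f1-> /f2//]].
by have [y yz] := o2 z; have [x xy] := o1 y; exists x; apply/T12; exists y.
Qed.

Lemma onto_function_right_factors (P Q : finType) (c : factors P Q)
    (w : network F (compose c)) :
  well_labelled c -> all (may_precede Type4') (labels c) ->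
  onto_function (relswap (Xrel w)).
Proof.
elim: c w => [P' Q' t G|P' Q' R' t G c IH] w /=.
  by move=> tG; rewrite andbT => nt; apply: onto_function_right _ tG _ => t3; rewrite t3 in nt.
case=> tG lc /andP[nt nc].
apply: onto_function_comp (is_relcomp_swap (Xrel_glue (gluing_iocomp G (compose c)) w)) _ _.
  exact: IH.
by apply: onto_function_right _ tG _ => t3; rewrite t3 in nt.
Qed.

End LeftGood.

(** * The rank of a semi-elementary factorization *)

Lemma card_inputs P Q (G : iograph P Q) : #|[set v : vert G | is_input v]| = #|P|.
Proof. by rewrite cardsE (card_codom (@inp_inj _ _ G)). Qed.

Lemma type4'P t : t = Type4' \/ t <> Type4'.
Proof. by case: t; [right|right|right|left]. Qed.

(** The separator is the boundary in front of the first type 4' factor, or the output set if there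
    is none. The factors before it do not change the rank, and the composite of those after it has
    as rank the dimension of its input data. *)
Lemma factors_separation (P Q : finType) (c : factors P Q) :
  well_labelled c -> pairwise may_precede (labels c) ->
  exists L R : {set vert (compose c)}, io_separation L R /\
    forall (F : fieldType) (w : network F (compose c)),
      relrank (Xrel w) = (2 * #|L :&: R|)%N.
Proof.
have right_case P' Q' (c' : factors P' Q') : well_labelled c' ->
    all (may_precede Type4') (labels c') ->
    exists L R : {set vert (compose c')}, io_separation L R /\
    forall (F : fieldType) (w : network F (compose c')),
      relrank (Xrel w) = (2 * #|L :&: R|)%N.
  move=> lc rc; exists [set v | is_input v], [set: vert (compose c')]; split.
    by apply/io_separationP; split=> [p|q|v|e]; rewrite ?inE ?orbT ?is_input_inp.
  move=> F w; rewrite setIT card_inputs -(dim_bdata F) -relrank_swap.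
  exact/relrank_onto_function/onto_function_right_factors.
elim: c => [P' Q' t G|P' Q' R' t G c IH] tG.
  have [t4|nt4] := type4'P t; move=> _.
    by apply: right_case => //; rewrite t4.
  exists [set: vert G], [set v | is_output v]; split.
    by apply/io_separationP; split=> *; rewrite ?inE ?is_output_out.
  move=> F w; rewrite setTI (card_inputs (opio G)) -(dim_bdata F).
  exact/relrank_onto_function/(onto_function_left w tG nt4).
have [t4|nt4] := type4'P t; move=> labs.
  apply: right_case => //; move: labs; rewrite /= t4 => /andP[h _].
  by rewrite h.
case: tG => /= tG lc; move: labs => /= /andP[_ /(IH lc)[L [R [sep rkE]]]].
have g := gluing_iocomp G (compose c).
(* The first factor lies wholly on the left side, and the separator of the remaining ones is
   kept. *)
pose L' := [set v : vert (iocomp G (compose c)) |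
  (v \in codom (vl g)) || (v \in [set vr g x | x in L])].
exists L', [set vr g x | x in R].
have sep_in x : x \in R -> vr g x \in codom (vl g) -> x \in L.
  move=> xR /codomP[a] /esym/vl_vr[q _ <-].
  by case/io_separationP: sep.
have cardE : #|L' :&: [set vr g x | x in R]| = #|L :&: R|.
  rewrite -(card_imset _ (@vr_inj _ _ _ _ _ _ g)); apply: eq_card => v; rewrite !inE.
  apply/andP/imsetP => [[vL /imsetP[x xR vE]]|[x /setIP[xL xR] ->]].
    exists x => //; rewrite inE xR andbT; move: vL; rewrite vE.
    case/orP=> [/(sep_in _ xR)//|/imsetP[y yL /vr_inj->]//].
  by split; [apply/orP; right|]; apply/imsetP; exists x.
split; last first.
  move=> F w; rewrite (relrank_comp_onto_function (Xrel_glue g w)); last first.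
    exact: onto_function_left tG nt4.
  by rewrite rkE cardE.
have [hA hB cov nLR] := io_separationP _ _ sep.
apply/io_separationP; split=> [p|q|v|e].
- by rewrite inE (inp_vl g) codom_f.
- by rewrite (out_vr g) imset_f.
- rewrite inE; case: (vl_vr_cover g v) => -[x <-]; first by rewrite codom_f.
  by case/orP: (cov x) => xLR; rewrite (imset_f _ xLR) ?orbT.
case: (el_er_cover g e) => -[x <-].
  by move=> _; rewrite inE head_el codom_f.
rewrite etail_head_rev rev_er !head_er ehead_rev => xR.
by rewrite inE imset_f ?orbT // nLR //; apply: contra xR => xR; rewrite imset_f.
Qed.

Lemma io_separation_iso (P Q : finType) (G H : iograph P Q) (L R : {set vert G}) :
  ioiso G H -> io_separation L R ->
  exists L' R' : {set vert H}, io_separation L' R' /\ #|L' :&: R'| = #|L :&: R|.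
Proof.
case=> fV [fE [bV bE [hE rE] iE oE]] /io_separationP[hA hB cov nLR].
have [gV gK fK] := bV; have [gE gEK fEK] := bE.
exists (fV @: L), (fV @: R); split; last first.
  by rewrite -imsetI ?card_imset //; [|move=> x y _ _]; apply: bij_inj.
have inE' (S : {set vert G}) v : (fV v \in fV @: S) = (v \in S).
  by rewrite mem_imset //; apply: bij_inj.
apply/io_separationP; split=> [p|q|v|e].
- by rewrite iE inE'.
- by rewrite oE inE'.
- by rewrite -(fK v) !inE'.
by rewrite -(fEK e) etail_head_rev rE !hE !inE' ehead_rev; apply: nLR.
Qed.

(** The rank is twice the order of a separation, hence at least [2 * max_paths G];
    [relrank_le_max_paths] is the reverse bound. *)
Lemma relrank_semi_elementary (P Q : finType) (G : iograph P Q) :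
  semi_elementary G -> forall (F : fieldType) (w : network F G),
    relrank (Xrel w) = (2 * max_paths G)%N.
Proof.
case=> c [lc pc iso] F w; have [L [R [sep rkE]]] := factors_separation lc pc.
have [L' [R' [sep' cardE]]] := io_separation_iso iso sep.
have rk : relrank (Xrel w) = (2 * #|L' :&: R'|)%N.
  by have [w' <-] := Xrel_iso w iso; rewrite rkE cardE.
apply/eqP; rewrite eqn_leq relrank_le_max_paths rk leq_mul2l /=.
exact: max_paths_le.
Qed.

(** * Generic flows *)

Lemma nat_avoids (F : numFieldType) (s : seq F) : exists n : nat, (n.+1)%:R%R \notin s.
Proof.
apply: NNPP => none; pose t := [seq (n.+1)%:R%R | n <- iota 0 (size s).+1] : seq F.
have := @uniq_leq_size _ t s; rewrite size_map size_iota ltnn => h.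
apply/notF/h.
  rewrite map_inj_uniq ?iota_uniq // => m n /eqP.
  by rewrite eqr_nat => /eqP[].
move=> x /mapP[n _ ->]; apply: contraT => ns.
by case: none; exists n.
Qed.

Section Generic.

Local Open Scope ring_scope.

Variables (F : numFieldType) (E : Type) (I : finType) (Phi : (E -> F) -> Prop).
Variable phi : I -> (E -> F) -> F.
Hypothesis Phi0 : Phi (fun=> 0).
Hypothesis Phi_lin : forall f g t, Phi f -> Phi g -> Phi (fun e => f e + t * g e).
Hypothesis phi_lin : forall i f g t,
  phi i (fun e => f e + t * g e) = phi i f + t * phi i g.

(* A vector space over an infinite field is not a finite union of proper
   subspaces. *)
Lemma generic_vector : exists2 f, Phi f &
  forall i, phi i f = 0 -> forall g, Phi g -> phi i g = 0.
Proof.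
suff [f Pf hf] : exists2 f, Phi f & forall i, i \in enum I ->
    phi i f = 0 -> forall g, Phi g -> phi i g = 0.
  by exists f => // i; apply: hf; rewrite mem_enum.
elim: (enum I) => [|i s [f Pf hf]]; first by exists (fun=> 0).
case: (classic (forall g, Phi g -> phi i g = 0)) => [all0|].
  by exists f => // j; rewrite inE => /orP[/eqP->|/hf].
move=> nall; have [g ng] := not_all_ex_not _ _ nall.
have [Pg gi] := imply_to_and _ _ ng.
(* When [phi j g] is nonzero, [phi j] vanishes at [f + t * g] for exactly one [t]; these values are
   avoided. *)
have [n ns] := nat_avoids [seq - phi j f / phi j g | j <- i :: s].
exists (fun e => f e + n.+1%:R * g e); first exact: Phi_lin.
move=> j js; rewrite phi_lin => fg0.
have [gj|gj] := eqVneq (phi j g) 0.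
  move: js fg0; rewrite inE => /orP[/eqP ji|js]; first by rewrite -ji in gi.
  by rewrite gj mulr0 addr0; apply: hf.
case/negP: ns; apply/mapP; exists j => //.
by apply: (mulIf gj); rewrite divfK //; apply/eqP; rewrite -addr_eq0 addrC fg0.
Qed.

End Generic.

Section Flows.

Local Open Scope ring_scope.

Variables (F : numFieldType) (G : multigraph).
Implicit Types (e : edge G) (v : vert G) (f g : edge G -> F).

Definition div f v : F := \sum_(e | ehead e == v) f e.

(** Like the current of a potential, a skew function changes sign under reversal and vanishes on
    loops; the loop condition allows it to be written as weight times potential difference. *)
Definition skew f :=
  (forall e, f (erev e) = - f e) /\ (forall e, ehead e = etail e -> f e = 0).

Lemma div_lin f g t v : div (fun e => f e + t * g e) v = div f v + t * div g v.
Proof. by rewrite /div big_split big_distrr. Qed.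

Lemma skew_lin f g t : skew f -> skew g -> skew (fun e => f e + t * g e).
Proof.
move=> [f1 f2] [g1 g2]; split=> [e|e el].
  by rewrite f1 g1 mulrN opprD.
by rewrite f2 // g2 // mulr0 addr0.
Qed.

Definition unit_flow e e' : F := (e' == e)%:R - (e' == erev e)%:R.

Lemma unit_flow_self e : unit_flow e e = 1.
Proof. by rewrite /unit_flow eqxx eq_sym (negbTE (erev_neq e)) subr0. Qed.

Lemma div_unit_flow e v : div (unit_flow e) v = (v == ehead e)%:R - (v == etail e)%:R.
Proof.
have sum1 e0 : \sum_(e' | ehead e' == v) (e' == e0)%:R = (v == ehead e0)%:R :> F.
  have [->|nv] := eqVneq v (ehead e0).
    rewrite (bigD1 e0) //= eqxx big1 ?addr0 // => e' /andP[_ ne].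
    by rewrite (negbTE ne).
  by apply: big1 => e' he'; case: (e' =P e0) => // E; move: nv; rewrite -E eq_sym he'.
by rewrite /div sumrB !sum1 ehead_rev.
Qed.

Lemma skew_unit_flow e : ehead e != etail e -> skew (unit_flow e).
Proof.
move=> nl; split=> [e'|e' l]; rewrite /unit_flow.
  by rewrite opprB (inj_eq (inv_inj (@erevK G))) (can2_eq (@erevK G) (@erevK G)).
have -> : (e' == e) = false by apply: contraNF nl => /eqP<-; apply/eqP.
have -> : (e' == erev e) = false; last by rewrite subrr.
by apply: contraNF nl => /eqP E; move: l; rewrite E ehead_rev etail_rev => ->.
Qed.

Definition edge_rel (D : pred (edge G)) : rel (vert G) :=
  fun x y => [exists e, [&& D e, etail e == x & ehead e == y]].

Lemma edge_rel_edge (D : pred (edge G)) e : D e -> edge_rel D (etail e) (ehead e).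
Proof. by move=> De; apply/existsP; exists e; rewrite De !eqxx. Qed.

Section EdgeRel.

Variable D : pred (edge G).
Hypothesis D_rev : forall e, D (erev e) = D e.

Lemma edge_rel_sym : connect_sym (edge_rel D).
Proof.
apply: sym_connect_sym => x y; apply/existsP/existsP => -[e /and3P[De /eqP<- /eqP<-]];
  by exists (erev e); rewrite D_rev De etail_rev ehead_rev !eqxx.
Qed.

Lemma path_flow x y : connect (edge_rel D) x y ->
  exists f, [/\ skew f, forall e, ~~ D e -> f e = 0 &
    forall v, div f v = (v == y)%:R - (v == x)%:R].
Proof.
case/connectP=> p + ->; elim: p x => [|z p IH] x /=.
  exists (fun=> 0); split=> [|//|v]; first by split=> // e; rewrite oppr0.
  by rewrite /div big1 // subrr.
case/andP=> /existsP[e /and3P[De /eqP ex /eqP ez]] /IH[f [sf fD fdiv]].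
(* A loop on the path is skipped, since its unit flow would not be skew. *)
have [xz|xz] := eqVneq z x.
  by exists f; split=> // v; rewrite fdiv -xz.
exists (fun e' => f e' + 1 * unit_flow e e'); split.
- by apply: skew_lin => //; apply: skew_unit_flow; rewrite ex ez.
- move=> e' De'; rewrite fD // /unit_flow.
  have -> : (e' == e) = false by apply: contraNF De' => /eqP->.
  have -> : (e' == erev e) = false by apply: contraNF De' => /eqP->; rewrite D_rev.
  by rewrite subrr mulr0 addr0.
by move=> v; rewrite div_lin fdiv div_unit_flow ex ez; ring.
Qed.

End EdgeRel.

End Flows.

(** * Irreducible tight graphs *)

Section Irreducible.

Local Open Scope ring_scope.

Variables (F : numFieldType) (P Q : finType) (G : iograph P Q).
Implicit Types (e : edge G) (v : vert G) (f g : edge G -> F).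

(** Inputs that are not outputs conserve flow too, as zero input current demands in
    [mem_Xrel_0l]. *)
Definition flow f := skew f /\ forall v, ~~ is_output v -> div f v = 0.

(* An edge through which no flow can pass is a bridge once all outputs are
   identified. *)
Lemma dead_edge_cut e : ehead e != etail e -> (forall f, flow f -> f e = 0) ->
  exists K : {set vert G}, [/\ forall v, v \in K -> ~~ is_output v,
    (ehead e \in K) != (etail e \in K) &
    forall e', e' != e -> e' != erev e -> (ehead e' \in K) = (etail e' \in K)].
Proof.
move=> nl dead; pose N := [pred e' | (e' != e) && (e' != erev e)].
have N_rev e' : N (erev e') = N e'.
  rewrite /= (inj_eq (inv_inj (@erevK G))) (can2_eq (@erevK G) (@erevK G)).
  by rewrite andbC.
have Ne : ~~ N e by rewrite /= eqxx.
pose K v := [set x | connect (edge_rel N) v x].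
have Kv v : v \in K v by rewrite inE connect0.
have KN v e' : e' != e -> e' != erev e -> (ehead e' \in K v) = (etail e' \in K v).
  move=> n1 n2; have Ne' : N e' by rewrite /= n1.
  rewrite !inE; apply/idP/idP => h; apply: connect_trans h _; last first.
    exact/connect1/edge_rel_edge.
  by rewrite edge_rel_sym //; apply/connect1/edge_rel_edge.
(* A connection of the ends avoiding [e] would close it to a cycle, whose flow is 1 on [e]. *)
have nhead_tail : etail e \notin K (ehead e).
  apply/negP; rewrite inE => /(path_flow F N_rev)[f [sf fN fdiv]].
  have /dead/eqP : flow (fun e' => f e' + 1 * unit_flow F e e').
    split=> [|v _]; first exact/skew_lin/skew_unit_flow.
    by rewrite div_lin fdiv div_unit_flow; ring.
  by rewrite fN // unit_flow_self add0r mulr1 oner_eq0.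
have ntail_head : ehead e \notin K (etail e).
  by move: nhead_tail; rewrite !inE edge_rel_sym.
have [noc|/forall_inPn[oc oK /negPn oO]] := boolP [forall v in K (ehead e), ~~ is_output v].
  exists (K (ehead e)); split; [exact/forall_inP| | exact: KN].
  by rewrite Kv (negbTE nhead_tail).
have [noa|/forall_inPn[oa aK /negPn aO]] := boolP [forall v in K (etail e), ~~ is_output v].
  exists (K (etail e)); split; [exact/forall_inP| | exact: KN].
  by rewrite Kv (negbTE ntail_head).
move: oK aK; rewrite !inE => /(path_flow F N_rev)[f [sf fN fdiv]].
case/(path_flow F N_rev)=> g [sg gN gdiv].
(* If both sides reach an output, a unit flow runs from [oa] through [e] to [oc]. *)
have /dead/eqP : flow (fun e' => (f e' + -1 * g e') + 1 * unit_flow F e e').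
  split=> [|v nv]; first by apply: skew_lin; [apply: skew_lin|apply: skew_unit_flow].
  rewrite div_lin div_lin fdiv gdiv div_unit_flow.
  have -> : (v == oc) = false by apply: contraNF nv => /eqP->.
  have -> : (v == oa) = false by apply: contraNF nv => /eqP->.
  by ring.
by rewrite fN // gN // unit_flow_self mulr0 addr0 add0r mulr1 oner_eq0.
Qed.

Definition tight := forall (w : network F G) y, (0, y) \in Xrel w -> y = 0.

(** The pieces that a type 3' factor can remove: all edges leaving [K] end at one and the same
    input. *)
Definition hanging (K : {set vert G}) :=
  [/\ K != set0, forall v, v \in K -> ~~ is_output v,
      forall e, etail e \in K -> ehead e \notin K -> is_input (ehead e) &
      forall e e', etail e \in K -> ehead e \notin K ->
        etail e' \in K -> ehead e' \notin K -> ehead e = ehead e'].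

(** An input of degree one, which a type 1 factor can move to the other end of its edge. *)
Definition spike e :=
  [/\ is_input (etail e), ~~ is_output (etail e), ~~ is_input (ehead e) &
      forall e', etail e' = etail e -> e' = e].

Hypothesis no_input_edge : forall e, ~~ (is_input (ehead e) && is_input (etail e)).
Hypothesis no_hanging : forall K, ~ hanging K.
Hypothesis no_spike : forall e, ~ spike e.

(** The cut of [dead_edge_cut] is an output-free set joined to the rest by the dead edge alone. An
    input at the outer end would make this set hanging; one at the inner end would leave a smaller
    hanging set or a spike. *)
Lemma dead_edge_inputs e : ehead e != etail e -> (forall f, flow f -> f e = 0) ->
  ~~ is_input (ehead e) && ~~ is_input (etail e).
Proof.
have half e0 (K : {set vert G}) : (forall v, v \in K -> ~~ is_output v) ->
    etail e0 \in K -> ehead e0 \notin K ->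
    (forall e', e' != e0 -> e' != erev e0 -> (ehead e' \in K) = (etail e' \in K)) ->
    ~~ is_input (ehead e0) && ~~ is_input (etail e0).
  move=> KO tK hK KN.
  have leave e' : etail e' \in K -> ehead e' \notin K -> e' = e0.
    move=> t h; apply/eqP; apply: contraT => n1.
    have [e'E|n2] := eqVneq e' (erev e0); last by rewrite KN // t in h.
    by move: t; rewrite e'E etail_rev (negbTE hK).
  have nh : ~~ is_input (ehead e0).
    apply/negP => ih; apply: (no_hanging (K := K)); split=> //.
    - by apply/set0Pn; exists (etail e0).
    - by move=> e' t h; rewrite (leave e').
    - by move=> e1 e2 t1 h1 t2 h2; rewrite (leave e1) // (leave e2).
  rewrite nh /=; apply/negP => it.
  have leave1 e' : etail e' \in K :\ etail e0 -> ehead e' \notin K :\ etail e0 ->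
      ehead e' = etail e0.
    rewrite !inE negb_and negbK => /andP[nt t] /orP[/eqP//|h].
    by move: nt; rewrite (leave e') ?eqxx.
  (* Without its input end, [K] has all leaving edges ending at that input. If nothing remains, [e0]
     is a spike, loops at inputs being excluded by [no_input_edge]. *)
  have [K1|nK1] := eqVneq (K :\ etail e0) set0; last first.
    apply: (no_hanging (K := K :\ etail e0)); split=> //.
    - by move=> v /setD1P[_ /KO].
    - by move=> e' t h; rewrite (leave1 e').
    - by move=> e1 e2 t1 h1 t2 h2; rewrite (leave1 e1) // (leave1 e2).
  apply: (no_spike (e := e0)); split=> //; first exact: KO.
  move=> e' te'; apply: leave; first by rewrite te'.
  apply/negP => h.
  have : ehead e' \notin K :\ etail e0 by rewrite K1 inE.
  rewrite !inE h andbT negbK => /eqP he'.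
  by have := no_input_edge e'; rewrite he' te' it.
move=> nl /(dead_edge_cut nl)[K [KO hx KN]].
have [tK|tK] := boolP (etail e \in K).
  by apply: (half e K) => //; move: hx; rewrite tK; case: (_ \in K).
rewrite andbC -{1}(ehead_rev e) -(etail_rev e); apply: (half _ K) => //.
- by move: hx; rewrite (negbTE tK) etail_rev; case: (_ \in K).
- by rewrite ehead_rev.
- by move=> e' n1 n2; apply: KN => //; move: n2; rewrite erevK.
Qed.

Lemma tight_irreducible_type3' : tight -> type3' G.
Proof.
move=> tG.
(* Genericity is asked for on edges, to control where the flow vanishes, and for divergences, to
   separate outputs at the end. *)
pose phi (i : edge G + vert G) f := match i with inl e => f e | inr v => div f v end.
have [||i f g t|f0 [[f0rev f0loop] f0div] f0gen] := @generic_vector F (edge G) _ flow phi.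
- split=> [|v _]; first by split=> // e; rewrite oppr0.
  by rewrite /div big1.
- move=> f g t [sf df] [sg dg]; split; first exact: skew_lin.
  by move=> v nv; rewrite div_lin df // dg // mulr0 addr0.
- by case: i => //= v; rewrite div_lin.
have f0e e : f0 e = 0 -> forall g, flow g -> g e = 0 := f0gen (inl e).
have f0v v : div f0 v = 0 -> forall g, flow g -> div g v = 0 := f0gen (inr v).
pose D := [pred e | f0 e == 0].
have D_rev e : D (erev e) = D e by rewrite /= f0rev oppr_eq0.
pose rt := fingraph.root (edge_rel D).
(* Each class of vertices joined by dead edges gets its own integer; the successor keeps it nonzero,
   so [u] vanishes exactly on the inputs. *)
pose u := [ffun v => if is_input v then 0 else (enum_rank (rt v)).+1%:R] : {ffun vert G -> F^o}.
have u0 v : (u v == 0) = is_input v.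
  by rewrite ffunE; case: ifP => _; rewrite ?eqxx // pnatr_eq0.
have u_dead e : f0 e = 0 -> u (ehead e) = u (etail e).
  move=> e0; have [->//|nl] := eqVneq (ehead e) (etail e).
  have /andP[nh nt] := dead_edge_inputs nl (f0e e e0).
  rewrite !ffunE (negbTE nh) (negbTE nt); congr (_.+1%:R); congr (val (enum_rank _)).
  apply/esym/(fingraph.rootP (edge_rel_sym D_rev))/connect1/edge_rel_edge.
  exact/eqP.
(* If dead edges joined the ends of a live edge, closing them with it would give a flow through dead
   edges. So the connecting flow would be zero, against its divergence at the tail. *)
have u_live e : f0 e != 0 -> u (ehead e) - u (etail e) != 0.
  move=> e0; have nl : ehead e != etail e by apply: contra e0 => /eqP/f0loop->.
  rewrite subr_eq0; apply/negP => ue.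
  have iht : is_input (ehead e) = is_input (etail e) by rewrite -!u0 (eqP ue).
  have := no_input_edge e; rewrite iht andbb => nt.
  move: ue; rewrite !ffunE iht (negbTE nt) eqr_nat eqSS.
  move/eqP/val_inj/enum_rank_inj/(fingraph.rootP (edge_rel_sym D_rev)).
  case/(path_flow F D_rev)=> g [sg gD gdiv].
  have fl : flow (fun e' => g e' + 1 * unit_flow F e e').
    split=> [|v _]; first exact/skew_lin/skew_unit_flow.
    by rewrite div_lin gdiv div_unit_flow; ring.
  have g0 e' : g e' = 0.
    have [De'|] := boolP (D e'); last exact: gD.
    have := f0e e' (eqP De') _ fl; rewrite /unit_flow.
    have -> : (e' == e) = false by apply: contraNF e0 => /eqP<-.
    have -> : (e' == erev e) = false.
      by apply: contraNF e0 => /eqP E; move: De'; rewrite E D_rev.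
    by rewrite subrr mulr0 addr0.
  have := gdiv (etail e); rewrite /div big1 // eqxx eq_sym (negbTE nl) subr0.
  by move/eqP; rewrite eq_sym oner_eq0.
pose wt e : F := if f0 e == 0 then 1 else f0 e / (u (ehead e) - u (etail e)).
have wt0 e : wt e != 0.
  rewrite /wt; case: ifP => e0; rewrite ?oner_eq0 //.
  by rewrite mulf_neq0 ?invr_eq0 ?u_live ?e0.
have wt_rev e : wt (erev e) = wt e.
  rewrite /wt f0rev oppr_eq0 ehead_rev etail_rev; case: ifP => // _.
  by rewrite -(opprB (u (ehead e))) invrN mulrNN.
pose w := Network wt0 wt_rev.
have lapE v : laplacian w u v = div f0 v.
  apply: eq_bigr => e _; rewrite /= /wt; case: ifP => [/eqP e0|/negbT e0].
    by rewrite u_dead // subrr mulr0 e0.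
  by rewrite divfK // u_live.
(* With these weights the current of [u] is [f0], so its output data are related to zero input data
   and tightness makes them vanish. *)
have y0 : (([ffun q => u (out G q)], [ffun q => div f0 (out G q)]) : bdata F Q) = 0.
  apply: (tG w); apply/mem_Xrel_0l; exists u; split=> [v|v nv|q|q].
  - by move=> iv; apply/eqP; rewrite u0.
  - by rewrite lapE f0div.
  - by rewrite ffunE.
  - by rewrite lapE ffunE.
have [y1 y2] : (forall q, u (out G q) = 0) /\ (forall q, div f0 (out G q) = 0).
  case: y0 => /ffunP y1 /ffunP y2; split=> q.
    by have := y1 q; rewrite !ffunE.
  by have := y2 q; rewrite !ffunE.
split=> [v /is_outputP[q <-]|v v' ov ov' nv]; first by rewrite -u0 y1.
apply/eqP => cc; have : v' \in component v by rewrite cc mem_component.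
rewrite inE => cvv'.
have {}cvv' : connect (edge_rel predT) v v'.
  apply: connect_sub cvv' => x y /existsP[e /andP[/eqP<- /eqP<-]].
  exact/connect1/edge_rel_edge.
(* A unit flow between two outputs of one component has nonzero divergence at [v'], where by
   genericity every flow has divergence zero. *)
have [g [sg _ gdiv]] := path_flow F (D := predT) (fun=> erefl) cvv'.
have fl : flow g.
  split=> // x nx; rewrite gdiv.
  have -> : (x == v) = false by apply: contraNF nx => /eqP->.
  have -> : (x == v') = false by apply: contraNF nx => /eqP->.
  by rewrite subrr.
have /is_outputP[q qv'] := ov'.
have := f0v _ (y2 q) _ fl; rewrite qv' gdiv eqxx eq_sym (negbTE nv) subr0.
by move/eqP; rewrite oner_eq0.
Qed.

End Irreducible.

(** * Reduction of tight graphs *)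

Lemma ioiso_sym (P Q : finType) (G H : iograph P Q) : ioiso G H -> ioiso H G.
Proof.
case=> fV [fE [[gV fVK gVK] [gE fEK gEK] [hE rE] iE oE]]; exists gV, gE; split.
- by exists fV.
- by exists fE.
- split=> e; rewrite -{2}(gEK e); first by rewrite hE fVK.
  by rewrite rE fEK.
- by move=> p; rewrite iE fVK.
- by move=> q; rewrite oE fVK.
Qed.

Lemma ioiso_trans (P Q : finType) (G H K : iograph P Q) :
  ioiso G H -> ioiso H K -> ioiso G K.
Proof.
case=> fV [fE [bV bE [hE rE] iE oE]] [gV [gE [bV' bE' [hE' rE'] iE' oE']]].
exists (gV \o fV), (gE \o fE); split=> [||| p | q] /=; try exact: bij_comp.
- by split=> e; rewrite ?hE' ?hE ?rE' ?rE.
- by rewrite iE' iE.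
- by rewrite oE' oE.
Qed.

Lemma glued_uniq (P Q R : finType) (A : iograph P Q) (B : iograph Q R) G H :
  glued A B G -> glued A B H -> ioiso G H.
Proof. by move=> /gluedP/ioiso_sym GAB /gluedP; apply: ioiso_trans. Qed.

Lemma opioK (P Q : finType) (G : iograph P Q) : opio (opio G) = G.
Proof. by case: G. Qed.

Lemma glued_isol (P Q R : finType) (A A' : iograph P Q) (B : iograph Q R) G :
  ioiso A' A -> glued A B G -> glued A' B G.
Proof.
move=> /ioiso_op iA /glued_op gAB; rewrite -[A']opioK -[B]opioK -[G]opioK.
exact/glued_op/(glued_isor iA).
Qed.

(** * Concatenation and reversal of factorizations *)

Fixpoint cat_factors P Q R (c : factors P Q) : factors Q R -> factors P R :=
  match c in factors P Q return factors Q R -> factors P R with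
  | LastFactor _ _ t G => fun d => ConsFactor t G d
  | ConsFactor _ _ _ t G c' => fun d => ConsFactor t G (cat_factors c' d)
  end.

Lemma labels_cat P Q R (c : factors P Q) (d : factors Q R) :
  labels (cat_factors c d) = labels c ++ labels d.
Proof. by elim: c d => [//|P' Q' R' t G c IH] d /=; rewrite IH. Qed.

Lemma well_labelled_cat P Q R (c : factors P Q) (d : factors Q R) :
  well_labelled c -> well_labelled d -> well_labelled (cat_factors c d).
Proof.
elim: c d => [//|P' Q' R' t G c IH] d /= [tG lc] ld.
by split=> //; apply: IH.
Qed.

Lemma glued_cat P Q R (c : factors P Q) (d : factors Q R) :
  glued (compose c) (compose d) (compose (cat_factors c d)).
Proof.
elim: c d => [P' Q' t G|P' Q' R' t G c IH] d /=.
  by apply/gluedP/ioiso_refl.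
have /gluedP iso_cd := IH d.
have := glued_assoc (inhabits (gluing_iocomp G (compose c)))
  (inhabits (gluing_iocomp (iocomp G (compose c)) (compose d))).
move/(glued_isor (ioiso_sym iso_cd))/gluedP/ioiso_sym.
apply: glued_iso; constructor; exact: gluing_iocomp.
Qed.

Lemma factors_op P Q (c : factors P Q) : well_labelled c ->
  exists d : factors Q P, [/\ well_labelled d,
    labels d = rev (map opposite_type (labels c)) &
    ioiso (compose d) (opio (compose c))].
Proof.
elim: c => [P' Q' t G|P' Q' R' t G c IH] /=.
  move=> /has_type_op tG; exists (LastFactor (opposite_type t) (opio G)).
  by split=> //; apply: ioiso_refl.
case=> tG /IH[d [ld labd isod]].
exists (cat_factors d (LastFactor (opposite_type t) (opio G))); split.
- by apply: well_labelled_cat => //; apply: has_type_op.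
- by rewrite labels_cat labd rev_cons cats1.
have g : glued (opio (compose c)) (opio G) (opio (iocomp G (compose c))).
  by apply: glued_op; constructor; apply: gluing_iocomp.
exact: glued_uniq (glued_cat d (LastFactor (opposite_type t) (opio G))) (glued_isol isod g).
Qed.

(** The condition on labels excludes exactly type 4'. *)
Definition left_factorizable (P Q : finType) (G : iograph P Q) :=
  exists c : factors P Q, [/\ well_labelled c,
    all (may_precede^~ Type3') (labels c) & ioiso (compose c) G].

Lemma left_factorizable_cons (P Q R : finType) t (A : iograph P Q)
    (B : iograph Q R) (G : iograph P R) :
  has_type t A -> may_precede t Type3' -> glued A B G ->
  left_factorizable B -> left_factorizable G.
Proof.
move=> tA nt gAB [c [lc rc iso]]; exists (ConsFactor t A c); split=> //=.
  by rewrite nt.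
by apply/gluedP; apply: glued_isor iso gAB.
Qed.

Section TightGlue.

Variables (F : fieldType) (P Q R : finType).
Variables (A : iograph P Q) (B : iograph Q R) (G : iograph P R).

(** Zero data on [A] extend a pair [(0, y)] from [B] to [G], for the extended weights. *)
Lemma tight_right (F' : numFieldType) : glued A B G -> tight F' G -> tight F' B.
Proof.
case=> g tG w y By; apply: (tG (push_network (@er_inj _ _ _ _ _ _ g) (rev_er g) w)).
apply/(Xrel_glue g); exists 0%R; first exact: mem0v.
by rewrite (Xrel_weight (w' := w)) // => e; exact/push_weightE/er_inj.
Qed.

(** The rank over [A] is at least that over [G], hence the full dimension of the middle space, and
    [relrank_full] applies. *)
Lemma relrank_left : glued A B G ->
    (forall w : network F G, relrank (Xrel w) = 2 * #|Q|) ->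
  forall (w : network F A) y, (0%R, y) \in Xrel w -> y = 0%R.
Proof.
case=> g rG w y.
pose wG := push_network (@el_inj _ _ _ _ _ _ g) (rev_el g) w.
rewrite (Xrel_weight (w' := pull_l g wG)) => [|e]; last exact/esym/push_weightE/el_inj.
apply: relrank_full; apply/eqP; rewrite eqn_leq relrank_le_codomain /=.
by rewrite dim_bdata -(rG wG); apply: relrank_comp_left (Xrel_glue g wG).
Qed.

Lemma relrank_right : glued A B G ->
    (forall w : network F G, relrank (Xrel w) = 2 * #|Q|) ->
  forall (w : network F B) x, (x, 0%R) \in Xrel w -> x = 0%R.
Proof.
case=> g rG w x.
pose wG := push_network (@er_inj _ _ _ _ _ _ g) (rev_er g) w.
rewrite (Xrel_weight (w' := pull_r g wG)) => [|e]; last exact/esym/push_weightE/er_inj.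
apply: relrank_full_domain; apply/eqP; rewrite eqn_leq.
rewrite dim_bdata -{2}(rG wG) (relrank_comp_right (Xrel_glue g wG)) andbT.
by rewrite -(dim_bdata F) -relrank_swap relrank_le_codomain.
Qed.

End TightGlue.

Section SplitIO.

Variables (P Q : finType) (G : iograph P Q).
Variables (V1 V2 : {set vert G}) (E1 : {set edge G}).
Hypothesis inp1 : forall p, inp G p \in V1.
Hypothesis E1_rev : forall e, (erev e \in E1) = (e \in E1).
Hypothesis head1 : forall e, e \in E1 -> ehead e \in V1.

Local Notation A := (split_left V2 inp1 E1_rev head1).

Lemma split_left_input (z : vert A) : is_input z = is_input (val z).
Proof.
apply/is_inputP/is_inputP => -[p pz]; exists p; last exact: val_inj.
by rewrite -pz.
Qed.

Lemma split_left_output (z : vert A) : is_output z = (val z \in V2).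
Proof.
apply/is_outputP/idP => [[m <-]|z2]; first by have /setIP[] := valP m.
have zc : val z \in V1 :&: V2 by rewrite inE (valP z).
by exists (Sub (val z) zc : cut_vert V1 V2); apply: val_inj.
Qed.

End SplitIO.

Lemma component_sub (G : multigraph) (v : vert G) (S : {set vert G}) :
  v \in S -> (forall e : edge G, etail e \in S -> ehead e \in S) ->
  component v \subset S.
Proof.
move=> vS Scl; apply/subsetP => x; rewrite inE => /connectP[p + ->].
elim: p v vS => //= y p IH v vS /andP[/existsP[e /andP[/eqP ev /eqP ey]] yp].
by apply: IH yp; rewrite -ey Scl // ev.
Qed.

Lemma connect_first_edge (G : multigraph) (x y : vert G) :
  connect (@adj G) x y -> x != y -> exists e : edge G, etail e = x.
Proof.
case/connectP=> -[|z p] /= => [_ ->|]; first by rewrite eqxx.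
by case/andP=> /existsP[e /andP[/eqP ex _]] _ _ _; exists e.
Qed.

(** * Splitting off factors at the input side *)

Section Reductions.

Variables (P Q : finType) (G : iograph P Q).

(** Edges are counted along with vertices because splitting off a type 2 factor removes only
    edges. *)
Definition smaller (P' Q' : finType) (B : iograph P' Q') :=
  #|vert B| + #|edge B| < #|vert G| + #|edge G|.

Lemma card_split_right (V2 : {set vert G}) (E1 : {set edge G}) :
  #|sub_vert V2| + #|sub_edge (~: E1)| = #|V2| + #|~: E1|.
Proof. by rewrite !card_sig. Qed.

(** The left factor consists of the inputs and all edges between them; the right factor keeps every
    vertex. *)
Lemma split_input_edge (e0 : edge G) :
  is_input (ehead e0) -> is_input (etail e0) ->
  exists M (A : iograph P M) (B : iograph M Q),
    [/\ glued A B G, type2 A & smaller B].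
Proof.
move=> ih it; pose V1 := [set v : vert G | is_input v].
pose E1 := [set e : edge G | is_input (ehead e) && is_input (etail e)].
have inp1 p : inp G p \in V1 by rewrite inE is_input_inp.
have out2 q : out G q \in setT by rewrite inE.
have V12 v : (v \in V1) || (v \in [set: vert G]) by rewrite in_setT orbT.
have E1_rev e : (erev e \in E1) = (e \in E1) by rewrite !inE ehead_rev etail_rev andbC.
have head1 e : e \in E1 -> ehead e \in V1 by rewrite !inE => /andP[].
have head2 e : e \notin E1 -> ehead e \in [set: vert G] by rewrite inE.
exists _, (split_left setT inp1 E1_rev head1), (split_right V1 out2 E1_rev head2).
split; first exact: glued_split.
  move=> z; rewrite split_left_input split_left_output in_setT andbT.
  by have := valP z; rewrite inE.
rewrite /smaller [X in X < _](card_split_right setT E1) cardsT ltn_add2l.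
rewrite -cardsT; apply: proper_card; apply/properP; split; first exact: subsetT.
by exists e0; rewrite ?inE ?ih ?it.
Qed.

(** The left factor consists of the inputs, [K] and all edges touching [K]; its outputs are the
    inputs outside [K]. Two of these in one component would both be attached to [K], hence equal. *)
Lemma split_hanging (K : {set vert G}) : hanging K ->
  exists M (A : iograph P M) (B : iograph M Q),
    [/\ glued A B G, type3' A & smaller B].
Proof.
case=> K0 KO Ki K1; pose V1 := [set v : vert G | is_input v] :|: K.
pose E1 := [set e : edge G | (ehead e \in K) || (etail e \in K)].
have inp1 p : inp G p \in V1 by rewrite !inE is_input_inp.
have out2 q : out G q \in ~: K.
  by rewrite inE; apply/negP => /KO; rewrite is_output_out.
have V12 v : (v \in V1) || (v \in ~: K) by rewrite !inE; case: (v \in K); rewrite ?orbT.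
have E1_rev e : (erev e \in E1) = (e \in E1) by rewrite !inE ehead_rev etail_rev orbC.
have head1 e : e \in E1 -> ehead e \in V1.
  rewrite !inE => /orP[->|tK]; first by rewrite orbT.
  by have [hK|/(Ki _ tK)->] := boolP (ehead e \in K); rewrite ?orbT.
have head2 e : e \notin E1 -> ehead e \in ~: K by rewrite !inE negb_or => /andP[].
exists _, (split_left (~: K) inp1 E1_rev head1), (split_right V1 out2 E1_rev head2).
split; first exact: glued_split.
  split=> [z|z z' oz oz' nz].
    rewrite split_left_output split_left_input inE => zK.
    by have := valP z; rewrite !inE (negbTE zK) orbF.
  apply/eqP => cc; have : z' \in component z by rewrite cc mem_component.
  rewrite inE => czz'; have cz'z := czz'.
  rewrite (sym_connect_sym (@adj_sym _)) in cz'z.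
  have [e ez] := connect_first_edge czz' nz.
  have [e' e'z] := connect_first_edge cz'z (contra_neq esym nz).
  have attach (a : sub_edge E1) x : etail (m := sub_graph E1_rev head1) a = x ->
      val x \notin K -> etail (erev (val a)) \in K /\ ehead (erev (val a)) = val x.
    move=> <- /=; rewrite etail_rev => nK; have := valP a.
    by rewrite inE -(ehead_rev (val a)) (negbTE nK) orbF.
  move: oz oz'; rewrite !split_left_output !in_setC => zK z'K.
  have [t h] := attach _ _ ez zK; have [t' h'] := attach _ _ e'z z'K.
  case/eqP: nz; apply: val_inj; rewrite -h -h'.
  by apply: K1; rewrite ?h ?h'.
rewrite /smaller [X in X < _](card_split_right (~: K) E1) -addSn.
apply: leq_add; last exact: max_card.
rewrite -cardsT; apply: proper_card; apply/properP; split; first exact: subsetT.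
by have [v vK] := set0Pn _ K0; exists v; rewrite ?inE ?vK.
Qed.

(** The left factor consists of the inputs, the far end [x] and the edge; in the right factor [x]
    replaces [v] as an input. *)
Lemma split_spike (e : edge G) : spike e ->
  exists M (A : iograph P M) (B : iograph M Q),
    [/\ glued A B G, type1 A & smaller B].
Proof.
case=> iv nov nix uv; set v := etail e in iv nov uv; set x := ehead e in nix.
have nvx : v != x by apply: contraNneq nix => <-.
pose V1 := x |: [set v : vert G | is_input v].
pose E1 := [set e; erev e].
have inp1 p : inp G p \in V1 by rewrite !inE is_input_inp orbT.
have out2 q : out G q \in [set~ v].
  by rewrite !inE; apply: contraNneq nov => <-; apply: is_output_out.
have V12 z : (z \in V1) || (z \in [set~ v]).
  by rewrite !inE; have [->|] := eqVneq z v; rewrite ?iv ?orbT.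
have E1_rev a : (erev a \in E1) = (a \in E1).
  rewrite !inE orbC (inj_eq (inv_inj (@erevK G))).
  by rewrite (can2_eq (@erevK G) (@erevK G)).
have head1 a : a \in E1 -> ehead a \in V1.
  by rewrite !inE => /orP[]/eqP->; rewrite ?ehead_rev ?eqxx // iv orbT.
have head2 a : a \notin E1 -> ehead a \in [set~ v].
  rewrite !inE; apply: contra => /eqP av; rewrite orbC -(can2_eq (@erevK G) (@erevK G)).
  by rewrite (uv (erev a)) ?eqxx // etail_rev.
exists _, (split_left [set~ v] inp1 E1_rev head1), (split_right V1 out2 E1_rev head2).
set A := split_left _ _ _ _.
split; first exact: glued_split.
  have eE : e \in E1 by rewrite !inE eqxx.
  pose a : edge A := Sub e eE.
  have tl : val (etail a) = v by rewrite /= ehead_rev.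
  have hd : val (ehead a) = x by [].
  have edgeE (b : edge A) : b = a \/ b = erev a.
    by have := valP b; rewrite !inE => /orP[]/eqP be; [left|right]; apply: val_inj.
  have oA (z : vert A) : is_output z = (val z != v) by rewrite split_left_output !inE.
  move=> z; have [zv|nzv] := boolP ((val z == v) || (val z == x)).
    right; exists a; have nta : etail a != ehead a by rewrite -val_eqE tl hd.
    have zS : z \in [set etail a; ehead a] by rewrite !inE -!val_eqE tl.
    have compE : component z = [set etail a; ehead a].
      apply/eqP; rewrite eqEsubset component_sub //=; last first.
        by move=> b _; case: (edgeE b) => ->; rewrite ?ehead_rev !inE eqxx ?orbT.
      apply/subsetP => y; move: zS; rewrite !inE.
      have ta : adj (etail a) (ehead a) := adj_head a.
      have at' : adj (ehead a) (etail a) by rewrite adj_sym.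
      by case/orP=> /eqP-> /orP[]/eqP->; rewrite ?connect0 ?connect1.
    split=> //.
    - apply/setP => b; rewrite /component_edges in_set compE !inE.
      by case: (edgeE b) => ->; rewrite ?ehead_rev ?eqxx ?orbT.
    - by rewrite split_left_input oA tl iv eqxx.
    - by rewrite split_left_input oA hd nix eq_sym nvx.
  left; move: nzv; rewrite negb_or => /andP[zv zx].
  have compE : component z = [set z].
    apply/eqP; rewrite eqEsubset component_sub ?set11 ?sub1set ?mem_component //.
    move=> b /set1P bz; move: zv zx; rewrite -bz.
    by case: (edgeE b) => ->; rewrite ?etail_rev ?tl ?hd eqxx.
  split=> //.
  - apply/setP => b; rewrite /component_edges in_set compE in_set0; apply/negP => /set1P bz.
    by move: zv zx; rewrite -bz; case: (edgeE b) => ->; rewrite ?ehead_rev ?tl ?hd eqxx.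
  - by have := valP z; rewrite split_left_input !inE (negbTE zx).
  - by rewrite oA.
rewrite /smaller [X in X < _](card_split_right [set~ v] E1) -addSn.
apply: leq_add; last exact: max_card.
rewrite -cardsT; apply: proper_card; apply/properP; split; first exact: subsetT.
by exists v; rewrite !inE ?eqxx.
Qed.

End Reductions.

(** Induction on size: what remains after splitting off a factor is again tight, and an irreducible
    graph is itself one factor of type 3'. *)
Lemma tight_left_factorizable (F : numFieldType) (P Q : finType) (G : iograph P Q) :
  tight F G -> left_factorizable G.
Proof.
have [n] := ubnP (#|vert G| + #|edge G|).
elim: n P Q G => // n IH P Q G; rewrite ltnS => szG tG.
have step M (A : iograph P M) (B : iograph M Q) t : has_type t A ->
    may_precede t Type3' -> glued A B G -> smaller G B -> left_factorizable G.
  move=> tA nt gAB sB; apply: (left_factorizable_cons tA nt gAB).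
  apply: IH (tight_right gAB tG); exact: leq_trans sB szG.
case: (classic (exists e : edge G, is_input (ehead e) && is_input (etail e))) => [[e]|no_e].
  case/andP=> ih it; have [M [A [B [gAB tA sB]]]] := split_input_edge ih it.
  exact: (step M A B Type2).
case: (classic (exists K : {set vert G}, hanging K)) => [[K]|no_K].
  case/split_hanging=> M [A [B [gAB tA sB]]]; exact: (step M A B Type3').
case: (classic (exists e : edge G, spike e)) => [[e]|no_s].
  case/split_spike=> M [A [B [gAB tA sB]]]; exact: (step M A B Type1).
exists (LastFactor Type3' G); split=> //=; last exact: ioiso_refl.
apply: tight_irreducible_type3' tG => [e|K hK|e se].
- by apply/negP => he; apply: no_e; exists e.
- by apply: no_K; exists K.
- by apply: no_s; exists e.
Qed.

Lemma semi_elementary_relrank (P Q : finType) (G : iograph P Q) :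
  (forall (F : fieldType) (w : network F G), relrank (Xrel w) = (2 * max_paths G)%N) ->
  semi_elementary G.
Proof.
move=> rG; have [L [R [sep mE]]] := max_paths_separation G.
have [M [A [B [gAB cM]]]] := io_separation_glued sep.
have rM (F : fieldType) (w : network F G) : relrank (Xrel w) = 2 * #|M|.
  by rewrite rG -mE -cM.
(* Over the rationals, full rank through the middle object [M] makes [A] tight. *)
have [c [lc tc isoc]] : left_factorizable A.
  apply: (@tight_left_factorizable rat) => w; exact: relrank_left gAB (rM _) w.
(* The right half is factored from its output side, and the result is reversed by [factors_op]. *)
have [d [ld td isod]] : left_factorizable (opio B).
  apply: (@tight_left_factorizable rat) => w [y1 y2].
  rewrite -[0%R in X in X -> _]/(0%R, 0%R) Xrel_op oppr0.
  move/(relrank_right gAB (rM _)) => [-> /eqP].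
  by rewrite oppr_eq0 => /eqP->.
have [b [lb labb isob]] := factors_op ld.
have isoB : ioiso (compose b) B.
  by rewrite -[B]opioK; apply: ioiso_trans isob (ioiso_op isod).
exists (cat_factors c b); split.
- exact: well_labelled_cat.
- rewrite labels_cat labb.
  have rb : all (may_precede Type4') (rev (map opposite_type (labels d))).
    by rewrite all_rev all_map; apply: sub_all td => -[].
  have all_pw (s1 s2 : seq iotype) : all (may_precede^~ Type3') s1 ->
      all (may_precede Type4') s2 -> pairwise may_precede (s1 ++ s2).
    move=> h1 h2; elim: s1 h1 => [_|t s1 IH /= /andP[nt /[dup] h1 /IH->]].
      elim: s2 h2 => //= t s2 IH /andP[nt /[dup] h2 /IH ->]; rewrite andbT.
      by apply: sub_all h2; case: t nt => // _ [].
    by rewrite andbT (eq_all (_ : may_precede t =1 predT)) ?all_predT //; case: t nt => // _ [].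
  exact: all_pw.
- apply: glued_uniq (glued_cat c b) _.
  exact: glued_isol isoc (glued_isor isoB gAB).
Qed.

Theorem mainTheorem8 (P Q : finType) (G : iograph P Q) :
  semi_elementary G <->
  (forall (F : fieldType) (w : network F G),
     relrank (Xrel w) = (2 * max_paths G)%N).
Proof.
by split; [exact: relrank_semi_elementary | exact: semi_elementary_relrank].
Qed.
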